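(* Let $H$ be a self-adjoint operator on a complex Hilbert space $\mathcal{H}$ with projection-valued spectral measure $\mathcal{E}$. Let $m\in\mathbb{N}$, $m\geq 1$, let $a_1,\dots,a_m$ be distinct points in the open upper half-plane, let $\alpha_1,\dots,\alpha_m\in\mathbb{C}$ be the solution of the transposed Vandermonde system $\sum_{j=1}^m\alpha_j=1$ and $\sum_{j=1}^m\alpha_j a_j^k=0$ for $1\leq k\leq m-1$, and let $K$ be the associated $m$th order rational kernel with conjugate pole pairs $$K(x)=\frac{1}{2\pi i}\sum_{j=1}^m\frac{\alpha_j}{x-a_j}-\frac{1}{2\pi i}\sum_{j=1}^m\frac{\overline{\alpha_j}}{x-\overline{a_j}}.$$ Write $\alpha_j=\beta_j+i\gamma_j$ with $\beta_j,\gamma_j\in\mathbb{R}$. Then for any interval $[a,b]\subset\mathbb{R}$ (with $a<b$), $$\lim_{\epsilon\rightarrow 0^+}\int_a^b [K_{\epsilon}*\mathcal{E}](x)\,\mathrm{d}x = \mathcal{E}((a,b))+c_l\,\mathcal{E}(\{a\})+c_r\,\mathcal{E}(\{b\}),$$ where $$c_l=\frac{1}{\pi}\sum_{j=1}^m\bigl[\beta_j(\pi-\arg(a_j))+i\gamma_j\log|a_j|\bigr],\qquad c_r=\frac{1}{\pi}\sum_{j=1}^m\bigl[\beta_j\arg(a_j)-i\gamma_j\log|a_j|\bigr].$$ Moreover, if the poles are symmetric about the imaginary axis, so that $a_{m+1-j}=-\overline{a_j}$ for all $1\leq j\leq m$, then $c_l=c_r=1/2$.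
   Context: The projection-valued measure $\mathcal{E}$ of $H$ is the one given by the spectral theorem, so that $H=\int_{\mathrm{Sp}(H)}\lambda\,\mathrm{d}\mathcal{E}(\lambda)$ and $(H-z)^{-1}=\int_{\mathrm{Sp}(H)}\frac{1}{\lambda-z}\,\mathrm{d}\mathcal{E}(\lambda)$ for $z\notin\mathrm{Sp}(H)$, where $\mathrm{Sp}(H)$ is the spectrum of $H$. $m$th order kernel: a function $K\in L^1(\mathbb{R})$ such that (i) $\int_{\mathbb{R}}K(x)\,\mathrm{d}x=1$; (ii) $K(x)x^j$ is integrable and $\int_{\mathbb{R}}K(x)x^j\,\mathrm{d}x=0$ for $0<j<m$; (iii) there is a constant $C_K$ with $|K(x)|\leq C_K(1+|x|)^{-(m+1)}$ for all $x\in\mathbb{R}$. The rational function $K$ in the claim is such a kernel. For $\epsilon>0$, $K_\epsilon(x)=\epsilon^{-1}K(x/\epsilon)$, and $$[K_{\epsilon}*\mathcal{E}](x)=\int_{\mathrm{Sp}(H)}K_\epsilon(x-\lambda)\,\mathrm{d}\mathcal{E}(\lambda)=\frac{-1}{2\pi i}\sum_{j=1}^{m}\left[\alpha_j (H-(x-\epsilon a_j))^{-1}-\overline{\alpha_j} (H-(x-\epsilon \overline{a_j}))^{-1}\right],$$ a bounded operator for each $x\in\mathbb{R}$. $\arg(a_j)\in(0,\pi)$ is the principal argument. The limit of operators is understood strongly, that is, after applying both sides to an arbitrary vector $\psi\in\mathcal{H}$.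
   Formalization: The printed constants are false in general (c_l must be real); the formal theorem uses c_l=(1/π)Σ[β_j(π−arg a_j)−γ_j log|a_j|] and c_r=(1/π)Σ[β_j arg a_j+γ_j log|a_j|], i.e. the factor i before γ_j log|a_j| is replaced by −1. *)

(* Defs.v *)
From HB Require Import structures.
From mathcomp Require Import all_boot all_order all_algebra.
From mathcomp Require Import all_classical all_reals all_analysis.
From mathcomp Require Import complex.

Set Implicit Arguments.
Unset Strict Implicit.
Unset Printing Implicit Defensive.
Import Order.TTheory GRing.Theory Num.Theory.
Import numFieldNormedType.Exports.

Local Open Scope classical_set_scope.
Local Open Scope ring_scope.
Local Open Scope complex_scope.

(* The Hilbert space structure on a complete normed R[i]-module V is an inner
   product [dot], linear in its first argument and conjugate-linear in the
   second, that induces the norm of V. *)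
Definition induces_norm (R : realType) (V : completeNormedModType R[i])
    (dot : {dot V for Num.conj}) : Prop :=
  forall v : V, dot v v = `|v| ^+ 2.

Section operators.
Context (R : realType) (V : completeNormedModType R[i]).

(* A possibly unbounded operator; the values of [op_fun] outside [op_dom] are
   irrelevant. *)
Record operator := Operator {
  op_dom : set V;
  op_fun :> V -> V;
  op_dom0 : op_dom 0;
  op_domP : forall (c : R[i]) u v,
    op_dom u -> op_dom v -> op_dom (c *: u + v);
  op_linear : forall (c : R[i]) u v,
    op_dom u -> op_dom v -> op_fun (c *: u + v) = c *: op_fun u + op_fun v }.

Definition zero_operator : operator :=
  @Operator setT (fun=> 0) I (fun _ _ _ _ _ => I)
    (fun c _ _ _ _ => esym (etrans (addr0 _) (scaler0 _ c))).

HB.instance Definition _ := gen_eqMixin operator.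
HB.instance Definition _ := gen_choiceMixin operator.

(* (v, w) belongs to the graph of the adjoint of H. *)
Definition adjoint_graph (dot : {dot V for Num.conj}) (H : operator)
    (v w : V) : Prop :=
  forall u, op_dom H u -> dot (H u) v = dot u w.

Definition self_adjoint (dot : {dot V for Num.conj}) (H : operator) : Prop :=
  closure (op_dom H) = setT /\
  forall v w, (op_dom H v /\ H v = w) <-> adjoint_graph dot H v w.

Definition bounded_operator (B : V -> V) : Prop :=
  exists M : R, forall v, `|B v| <= M%:C * `|v|.

Definition resolvent_set (H : operator) : set R[i] :=
  [set z | exists B : {linear V -> V},
     [/\ bounded_operator B,
         forall v, op_dom H (B v) /\ H (B v) - z *: B v = v
       & forall u, op_dom H u -> B (H u - z *: u) = u]].

Definition spectrum (H : operator) : set R[i] := ~` resolvent_set H.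

(* The spectrum as a set of real numbers: Sp(H) is real for self-adjoint H. *)
Definition real_spectrum (H : operator) : set R :=
  [set x | spectrum H x%:C].

End operators.

Section spectral_measures.
Context (R : realType) (V : completeNormedModType R[i]).
Variable dot : {dot V for Num.conj}.

Definition orthogonal_projection (P : V -> V) : Prop :=
  (forall v, P (P v) = P v) /\ (forall u v, dot (P u) v = dot u (P v)).

(* Only the values of E on Borel sets matter. *)
Definition projection_valued_measure (E : set R -> {linear V -> V}) : Prop :=
  [/\ forall A, measurable A -> orthogonal_projection (E A),
      forall v, E setT v = v,
      forall A B, measurable A -> measurable B ->
        forall v, E (A `&` B) v = E A (E B v)
    & forall F : nat -> set R, (forall n, measurable (F n)) ->
        trivIset setT F ->
        forall v, series (fun n => E (F n) v) @ \oo --> E (\bigcup_n F n) v].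

Definition scalar_measure (E : set R -> {linear V -> V}) (v : V) :
    set R -> \bar R :=
  fun A => (complex.Re (dot (E A v) v))%:E.

Definition complex_integral (mu : set R -> \bar R) (D : set R)
    (f : R -> R[i]) : R[i] :=
  fine (\int[mu]_(x in D) (complex.Re (f x))%:E)%E +i*
  fine (\int[mu]_(x in D) (complex.Im (f x))%:E)%E.

(* T = \int_D f dE. On a complex space the quadratic form v |-> <T v, v>
   determines T on its domain. *)
Definition is_spectral_integral (E : set R -> {linear V -> V}) (D : set R)
    (f : R -> R[i]) (T : operator V) : Prop :=
  op_dom T = [set v |
    (\int[scalar_measure E v]_(x in D)
        ((complex.Re `|f x|) ^+ 2)%:E < +oo)%E] /\
  forall v, op_dom T v ->
    dot (T v) v = complex_integral (scalar_measure E v) D f.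

Definition spectral_integral (E : set R -> {linear V -> V}) (D : set R)
    (f : R -> R[i]) : operator V :=
  xget (zero_operator V) [set T | is_spectral_integral E D f T].

(* E is the projection-valued measure of H: it is concentrated on Sp(H) and
   H = \int_{Sp(H)} x dE(x). *)
Definition spectral_measure_of (H : operator V)
    (E : set R -> {linear V -> V}) : Prop :=
  [/\ projection_valued_measure E,
      forall v, E (real_spectrum H) v = v
    & is_spectral_integral E (real_spectrum H) (fun x => x%:C) H].

End spectral_measures.

(* Riemann integral of vector-valued functions: x is the subdivision of [a, b],
   t are the tags. *)
Section riemann.
Context (R : realType) (V : completeNormedModType R[i]).

Definition tagged_partition (a b : R) (n : nat) (x t : nat -> R) : Prop :=
  [/\ x 0%N = a, x n = b
    & forall k, (k < n)%N -> x k <= t k <= x k.+1].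

Definition riemann_sum (f : R -> V) (n : nat) (x t : nat -> R) : V :=
  \sum_(k < n) (x k.+1 - x k)%:C *: f (t k).

Definition is_riemann_integral (f : R -> V) (a b : R) (I : V) : Prop :=
  forall e : R, 0 < e -> exists2 d : R, 0 < d &
    forall n x t, tagged_partition a b n x t ->
      (forall k, (k < n)%N -> x k.+1 - x k < d) ->
      `|riemann_sum f n x t - I| < e%:C.

Definition riemann_integrable (f : R -> V) (a b : R) : Prop :=
  exists I, is_riemann_integral f a b I.

Definition riemann_integral (f : R -> V) (a b : R) : V :=
  xget 0 [set I | is_riemann_integral f a b I].

End riemann.

Section kernel.
Context (R : realType).

(* 'i and z^* are the imaginary unit and the conjugation of the closed field
   R[i]. *)
Definition rational_kernel (m : nat) (a alpha : 'I_m -> R[i]) (x : R) : R[i] :=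
  (2 * pi%:C * 'i)^-1 * (\sum_(j < m) alpha j / (x%:C - a j)) -
  (2 * pi%:C * 'i)^-1 *
    (\sum_(j < m) Num.conj (alpha j) / (x%:C - Num.conj (a j))).

Definition scaled_kernel (K : R -> R[i]) (eps x : R) : R[i] :=
  (eps^-1)%:C * K (x / eps).

(* Modulus as a real number: the norm of R[i] takes its values in R[i]. *)
Definition cmod (z : R[i]) : R := complex.Re `|z|.

(* Principal argument, in ]-pi, pi]. *)
Definition carg (z : R[i]) : R :=
  let theta := acos (complex.Re z / cmod z) in
  if 0 <= complex.Im z then theta else - theta.

(* With K the kernel of a and alpha, c_left is the integral of K over
   [0, +oo[ and c_right its integral over ]-oo, 0]. As \sum_j alpha_j = 1 is
   real, the primitive of x |-> alpha_j / (x - a_j) contributes the terms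
   Im (alpha_j) * ln |a_j|; both constants are real because K is. *)
Definition c_left (m : nat) (a alpha : 'I_m -> R[i]) : R :=
  pi^-1 * \sum_(j < m) (complex.Re (alpha j) * (pi - carg (a j)) -
                        complex.Im (alpha j) * ln (cmod (a j))).

Definition c_right (m : nat) (a alpha : 'I_m -> R[i]) : R :=
  pi^-1 * \sum_(j < m) (complex.Re (alpha j) * carg (a j) +
                        complex.Im (alpha j) * ln (cmod (a j))).

End kernel.

(* The operator [K_eps * E](x). *)
Definition smoothed_measure (R : realType) (V : completeNormedModType R[i])
    (dot : {dot V for Num.conj}) (H : operator V)
    (E : set R -> {linear V -> V}) (K : R -> R[i]) (eps x : R) : operator V :=
  spectral_integral dot E (real_spectrum H)
    (fun y => scaled_kernel K eps (x - y)).

(* Main.v *)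
From HB Require Import structures.
Require Import Defs.
From mathcomp Require Import all_boot all_order all_algebra.
From mathcomp Require Import all_classical all_reals all_analysis.
From mathcomp Require Import complex.
From mathcomp Require Import measurable_realfun.
From mathcomp Require Import zify ring lra.
Import Order.TTheory GRing.Theory Num.Theory.
Import numFieldNormedType.Exports.
Local Open Scope classical_set_scope.
Local Open Scope ring_scope.
Local Open Scope complex_scope.
Set Implicit Arguments.
Unset Strict Implicit.
Unset Printing Implicit Defensive.

(* Let G be the primitive of K with limits -1/2 and 1/2 at -oo and +oo (an
   explicit sum of arctangents and logarithms). Integrating in x first,
     \int_l^r [K_eps * E](x) dx = F_eps(H),
     F_eps(y) = G((r - y) / eps) - G((l - y) / eps),
   where the Riemann sums converge in operator norm because K is Lipschitz. As
   eps -> 0+ the functions F_eps stay bounded and converge pointwise to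
     1_(l,r) + (1/2 - G(0)) 1_{l} + (1/2 + G(0)) 1_{r},
   so F_eps(H) psi converges by dominated convergence for the scalar measure of
   psi. Finally 1/2 - G(0) = c_l and 1/2 + G(0) = c_r. For symmetric poles the
   moment conditions give alpha_{m+1-j} = conj alpha_j, whence c_l = c_r.

   The norm estimates on the operators f(H) all follow from the inequality
   |T v|^2 <= C <T v, v> for 0 <= T <= C. *)

(** * Real inner product of a complex Hilbert space *)

Section real_norm.
Context (R : realType).
Implicit Types (z : R[i]) (r : R).

(** [is_spectral_integral] records an operator only through its domain and its quadratic form <T v,
    v>. Norm estimates must therefore be drawn from the form, and positivity makes this possible;
    functions of variable sign are reduced to positive ones, at the price of constants such as 2 C.
    Since [spectral_integral] is a choice with the zero operator as default, f(H) has to be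
    constructed before anything can be said about the chosen operator. Two further obstacles come
    from the encodings. [E] is constrained on Borel sets only, so Sp(H) must be shown Borel before
    integrals over it can be compared with integrals over R; this is where the Neumann series
    enters. And the norm of [V] takes values in R[i], so [rnorm] and [rdot] extract the real
    quantities on which real analysis acts. *)

Lemma cmodE z : `|z| = (cmod z)%:C.
Proof. by rewrite /cmod RRe_real// normr_real. Qed.

Lemma cmod_real r : cmod r%:C = `|r|.
Proof. by rewrite /cmod normc_def /= expr0n addr0 sqrtr_sqr. Qed.

Lemma cmod_ge0 z : 0 <= cmod z.
Proof. by rewrite -ler0c -cmodE. Qed.

Lemma cmodM z w : cmod (z * w) = cmod z * cmod w.
Proof. by apply: complexI; rewrite rmorphM /= -!cmodE normrM. Qed.

Lemma cmodV z : cmod z^-1 = (cmod z)^-1.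
Proof. by apply: complexI; rewrite -cmodE normfV cmodE -fmorphV. Qed.

Lemma cmod_gt0 z : (0 < cmod z) = (z != 0).
Proof. by rewrite -normr_gt0 cmodE ltcE /= eqxx. Qed.

Lemma normr_Im_le z : `|complex.Im z| <= cmod z.
Proof.
by rewrite /cmod normc_def /= -sqrtr_sqr ler_wsqrtr// lerDr sqr_ge0.
Qed.

Lemma cmod_sqr z : cmod z ^+ 2 = complex.Re z ^+ 2 + complex.Im z ^+ 2.
Proof. by rewrite /cmod normc_def /= sqr_sqrtr// addr_ge0// sqr_ge0. Qed.

Variable V : normedModType R[i].
Implicit Types u v : V.

Definition rnorm v : R := complex.Re `|v|.

Lemma rnormE v : `|v| = (rnorm v)%:C.
Proof. by rewrite /rnorm RRe_real// normr_real. Qed.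

Lemma rnorm_ge0 v : 0 <= rnorm v.
Proof. by rewrite -ler0c -rnormE. Qed.

Lemma rnorm0 : rnorm (0 : V) = 0.
Proof. by rewrite /rnorm normr0. Qed.

Lemma rnorm_eq0 v : rnorm v = 0 -> v = 0.
Proof. by move=> v0; apply/eqP; rewrite -normr_eq0 rnormE v0. Qed.

Lemma rnormN v : rnorm (- v) = rnorm v.
Proof. by rewrite /rnorm normrN. Qed.

Lemma rnormBC u v : rnorm (u - v) = rnorm (v - u).
Proof. by rewrite -rnormN opprB. Qed.

Lemma ler_rnormD u v : rnorm (u + v) <= rnorm u + rnorm v.
Proof. by rewrite -lecR rmorphD /= -!rnormE ler_normD. Qed.

Lemma ler_rnormB u v : rnorm (u - v) <= rnorm u + rnorm v.
Proof. by rewrite (le_trans (ler_rnormD _ _))// rnormN. Qed.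

Lemma rnormZ (c : R[i]) v : rnorm (c *: v) = cmod c * rnorm v.
Proof. by apply: complexI; rewrite rmorphM /= -rnormE -cmodE -rnormE normrZ.
  Qed.

Lemma rnormZr (c : R) v : rnorm (c%:C *: v) = `|c| * rnorm v.
Proof. by rewrite rnormZ cmod_real. Qed.

Lemma cvg_rnorm (T : Type) (F : set_system T) {FF : Filter F} (f : T -> V) l :
  (forall e : R, 0 < e -> \forall x \near F, rnorm (l - f x) < e) -> f @ F -->
    l.
Proof.
move=> fl; apply/cvgrPdist_lt => -[e e'] /[dup] e0.
(* A positive element of R[i] has zero imaginary part, so every admissible radius is real. *)
rewrite ltcE /= => /andP[/eqP e'0 {}e0]; rewrite e'0.
by near=> x; rewrite rnormE ltcR; near: x; exact: fl.
Unshelve. all: by end_near. Qed.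

Lemma rnorm_cvg (T : Type) (F : set_system T) {FF : Filter F} (f : T -> V) l :
  f @ F --> l -> forall e : R, 0 < e -> \forall x \near F, rnorm (l - f x) < e.
Proof.
move=> /cvgrPdist_lt fl e e0; have e0' : 0 < e%:C :> R[i] by rewrite ltcR.
by apply: filterS (fl _ e0') => x; rewrite rnormE ltcR.
Qed.

End real_norm.

Lemma rnorm_cauchy_cvg (R : realType) (V : completeNormedModType R[i])
    (u : nat -> V) :
  (forall e : R, 0 < e -> exists N, forall m n, (N <= m)%N -> (N <= n)%N ->
     rnorm (u m - u n) < e) ->
  exists l : V, u @ \oo --> l.
Proof.
move=> uc; exists (lim (u @ \oo)); apply/cvg_ex.
suff : cvg (u @ \oo) by move=> /cvg_ex.
apply/cauchy_cvgP/cauchy_ballP => -[e e'] /[dup] e0.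
rewrite ltcE /= => /andP[/eqP e'0 {}e0]; rewrite e'0.
have [N uN] := uc _ e0.
near_simpl; exists ([set n | (N <= n)%N], [set n | (N <= n)%N]) => /=.
  by split; exists N.
move=> [m n] [/= Nm Nn]; rewrite -ball_normE /ball_ /= rnormE ltcR.
exact: uN.
Qed.

Section real_inner_product.
Context (R : realType) (V : completeNormedModType R[i]).
Variable dot : {dot V for Num.conj}.
Hypothesis dotP : induces_norm dot.
Implicit Types (u v w : V) (r : R).

Lemma dotDZl (c : R[i]) u v w : dot (c *: u + v) w = c * dot u w + dot v w.
Proof. by rewrite linearDl linearZl_LR. Qed.

Lemma dotZl (c : R[i]) u w : dot (c *: u) w = c * dot u w.
Proof. by rewrite -[_ *: u]addr0 dotDZl linear0l addr0. Qed.

Lemma dotC u v : dot u v = Num.conj (dot v u).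
Proof. by rewrite hermC /= expr0 mul1r. Qed.

Lemma dotDZr (c : R[i]) u v w :
  dot w (c *: u + v) = Num.conj c * dot w u + dot w v.
Proof. by rewrite linearDr linearZr_LR. Qed.

Definition rdot u v : R := complex.Re (dot u v).

Lemma rdotC u v : rdot u v = rdot v u.
Proof.
by rewrite /rdot dotC; case: (dot v u).
Qed.

Lemma rdotDl u v w : rdot (u + v) w = rdot u w + rdot v w.
Proof. by rewrite /rdot -{1}[u]scale1r dotDZl mul1r raddfD. Qed.

Lemma rdotZl r u w : rdot (r%:C *: u) w = r * rdot u w.
Proof.
by rewrite /rdot dotZl; case: (dot u w) => x y /=; rewrite mul0r subr0.
Qed.

Lemma rdotDr u v w : rdot w (u + v) = rdot w u + rdot w v.
Proof. by rewrite rdotC rdotDl !(rdotC w). Qed.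

Lemma rdotZr r u w : rdot w (r%:C *: u) = r * rdot w u.
Proof. by rewrite rdotC rdotZl (rdotC w). Qed.

Lemma rdotNl u w : rdot (- u) w = - rdot u w.
Proof. 
by apply/eqP; rewrite -addr_eq0 -rdotDl addNr /rdot linear0l.
 Qed.

Lemma rdotBl u v w : rdot (u - v) w = rdot u w - rdot v w.
Proof. by rewrite rdotDl rdotNl. Qed.

Lemma rdotNr u w : rdot w (- u) = - rdot w u.
Proof. by rewrite rdotC rdotNl rdotC. Qed.

Lemma rdotBr u v w : rdot w (u - v) = rdot w u - rdot w v.
Proof. by rewrite rdotDr rdotNr. Qed.

Lemma rdotvv v : rdot v v = rnorm v ^+ 2.
Proof. by rewrite /rdot dotP rnormE -rmorphXn. Qed.

Lemma rdotvv_ge0 v : 0 <= rdot v v.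
Proof. by rewrite rdotvv sqr_ge0. Qed.

Lemma rdot_CS u v : `|rdot u v| <= rnorm u * rnorm v.
Proof.
rewrite -(@ler_pXn2r _ 2)// ?nnegrE ?mulr_ge0 ?rnorm_ge0//.
rewrite exprMn -!rdotvv real_normK ?num_real//.
have [v0|v0] := eqVneq (rdot v v) 0.
  have v0' : v = 0 by apply: rnorm_eq0; apply/eqP; rewrite -sqrf_eq0 -rdotvv v0.
  have -> : rdot u v = 0 by rewrite v0' /rdot linear0r.
  by rewrite v0 mulr0 expr0n.
(* The component of [u] orthogonal to [v]: its square times |v|^2 is the gap in the inequality. *)
have : 0 <= rdot (u - (rdot u v / rdot v v)%:C *: v)
                 (u - (rdot u v / rdot v v)%:C *: v) by exact: rdotvv_ge0.
rewrite !(rdotBl, rdotBr, rdotZl, rdotZr) (rdotC v u).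
rewrite -subr_ge0 => h; rewrite -subr_ge0.
have vp : 0 < rdot v v by rewrite lt_def v0 rdotvv_ge0.
have := mulr_ge0 (ltW vp) h; congr (0 <= _); field; exact: v0.
Qed.

Lemma rdotl_cvg (u : nat -> V) l w : u @ \oo --> l ->
  (fun n => rdot (u n) w) @ \oo --> rdot l w.
Proof.
move=> /rnorm_cvg ul; apply/cvgrPdist_lt => e e0.
have d0 : 0 < e / (rnorm w + 1) by rewrite divr_gt0// ltr_wpDl// rnorm_ge0.
apply: filterS (ul _ d0) => n; rewrite ltr_pdivlMr ?ltr_wpDl ?rnorm_ge0//.
apply: le_lt_trans; rewrite -rdotBl (le_trans (rdot_CS _ _))//.
by rewrite ler_wpM2l ?rnorm_ge0// lerDl.
Qed.

(* Polarization, which requires complex scalars. *)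
Lemma rdot_sym (T : {linear V -> V}) :
  (forall v, complex.Im (dot (T v) v) = 0) ->
  forall u v, rdot (T u) v = rdot u (T v).
Proof.
move=> T0 u v.
have := T0 (1 *: u + v); have := T0 ('i *: u + v).
rewrite !linearP /= !(dotDZl, dotDZr) (rdotC u) /rdot rmorph1 !mul1r.
have := T0 u; have := T0 v; case: (dot (T u) u) => a b;
  case: (dot (T v) v) => c d.
case: (dot (T u) v) => p q; case: (dot (T v) u) => r s /=.
move=> -> -> e _; lra.
Qed.

(* Expand 0 <= <T w, w> at w = v - C^-1 T v. *)
Lemma rnorm_pos_operator (T : {linear V -> V}) (q : V -> R) (C : R) : 0 < C ->
  (forall v, dot (T v) v = (q v)%:C) ->
  (forall v, 0 <= q v <= C * rnorm v ^+ 2) ->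
  forall v, rnorm (T v) ^+ 2 <= C * q v.
Proof.
move=> C0 Tq q0 v; have Tsym : forall u v, rdot (T u) v = rdot u (T v).
  by apply: rdot_sym => w; rewrite Tq.
have qE w : q w = rdot (T w) w by rewrite /rdot Tq.
set w := v - (C^-1)%:C *: T v.
have /andP[+ _] := q0 w; have /andP[_] := q0 (T v).
rewrite !qE /w linearB linearZ /= -rdotvv.
rewrite !(rdotBl, rdotBr, rdotZl, rdotZr) (Tsym (T v) v).
set x := rdot (T (T v)) (T v); set y := rdot (T v) (T v); set z := rdot (T v) v.
move=> xy h; rewrite -subr_ge0.
have : 0 <= C * (z - C^-1 * y - (C^-1 * y - C^-1 * (C^-1 * x))).
  by rewrite mulr_ge0// ltW.
have -> : C * (z - C^-1 * y - (C^-1 * y - C^-1 * (C^-1 * x))) =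
    C * z - y - (y - C^-1 * x) by field; rewrite gt_eqF.
move=> h'; apply: le_trans h' _.
by rewrite lerBlDr lerDl subr_ge0 mulrC ler_pdivrMr// mulrC.
Qed.

End real_inner_product.

(** * The real spectrum is closed *)

Section neumann.
Context (R : realType) (V : completeNormedModType R[i]).
Implicit Types u v w : V.

Variable A : {linear V -> V}.
Hypothesis A_half : forall v, rnorm (A v) <= 2^-1 * rnorm v.

Lemma half_contraction_fixpoint_uniq v u w :
  u = v + A u -> w = v + A w -> u = w.
Proof.
move=> uE wE; apply/eqP; rewrite -subr_eq0; apply/eqP/rnorm_eq0.
have := A_half (u - w); rewrite linearB.
have -> : A u - A w = u - w by rewrite {2}uE {2}wE opprD addrACA subrr add0r.
by have := rnorm_ge0 (u - w); lra.
Qed.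

(** The iterates from 0 are the partial sums of the Neumann series at [v]: s (n + k) - s n is A^n
    applied to s k, hence geometrically small. *)
Lemma half_contraction_fixpoint v : exists u, u = v + A u.
Proof.
pose s n := iter n (fun u => v + A u) 0.
(* The radius 2 |v| is the fixed point of r |-> |v| + r / 2. *)
have sb k : rnorm (s k) <= 2 * rnorm v.
  elim: k => [|k ih]; first by rewrite rnorm0 mulr_ge0 ?rnorm_ge0.
  by rewrite (le_trans (ler_rnormD _ _))//; have := A_half (s k); lra.
have sd n k : rnorm (s (n + k)%N - s n) <= 2^-1 ^+ n * (2 * rnorm v).
  elim: n => [|n ih]; first by rewrite subr0 expr0 mul1r.
  rewrite addSn /= opprD addrACA subrr add0r -linearB exprS -mulrA.
  by rewrite (le_trans (A_half _))// ler_wpM2l.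
have [l sl] : exists l : V, s @ \oo --> l.
  apply: rnorm_cauchy_cvg => e e0.
  (* Both s m and s n lie within 2^-N * 2 |v| of s N, whence 4 |v|; the 1 keeps the divisor
     positive. *)
  have c0 : 0 < 4 * rnorm v + 1 by have := rnorm_ge0 v; lra.
  have [N _ Nh] : \forall n \near \oo, `|0 - 2^-1 ^+ n| < e / (4 * rnorm v + 1)
    :> R.
    have /cvgrPdist_lt := @cvg_expr R 2^-1 (ltac:(by rewrite ger0_norm; lra)).
    by apply; rewrite divr_gt0.
  have sN n : (N <= n)%N -> rnorm (s n - s N) <= 2^-1 ^+ N * (2 * rnorm v).
    by move=> /subnKC <-.
  exists N => m n /sN sm /sN sn.
  rewrite -(subrKA (s N)) (le_lt_trans (ler_rnormD _ _))// (rnormBC (s N)).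
  have := Nh _ (leqnn N); rewrite sub0r normrN ger0_norm ?exprn_ge0//.
  rewrite ltr_pdivlMr// mulrDr mulr1.
  have : 0 <= (2^-1 : R) ^+ N by rewrite exprn_ge0.
  by move: sm sn; set x := 2^-1 ^+ N; set y := rnorm v; lra.
exists l; apply/eqP; rewrite -subr_eq0; apply/eqP/rnorm_eq0.
apply/eqP; rewrite eq_le rnorm_ge0 andbT; apply/ler_addgt0Pl => e e0.
have e4 : 0 < e / 4 by rewrite divr_gt0.
have [N _ Nh] := rnorm_cvg sl e4.
have := Nh _ (leqnSn N); have := Nh _ (leqnn N); rewrite /= => h1 h2.
have -> : l - (v + A l) = l - (v + A (s N)) + A (s N - l).
  by rewrite linearB /= opprD opprD !addrA subrK.
rewrite addr0 (le_trans (ler_rnormD _ _))//.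
have := A_half (s N - l); rewrite rnormBC in h1; lra.
Qed.

(** S = (1 - A)^-1 sends [v] to the fixed point of u |-> v + A u; its linearity and the left inverse
    identity come from uniqueness of that point. *)
Lemma neumann_inverse : exists S : {linear V -> V},
  [/\ forall v, S v - A (S v) = v, forall v, S (v - A v) = v
    & forall v, rnorm (S v) <= 2 * rnorm v].
Proof.
have [S SE] := choice half_contraction_fixpoint.
have Slin : linear S.
  move=> c u v; apply: half_contraction_fixpoint_uniq (SE _) _.
  by rewrite linearP /= addrACA -scalerDr -!SE.
pose S' : {linear V -> V} := HB.pack S (GRing.isLinear.Build R[i] V V _ S Slin).
exists S'; split=> v /=.
- by rewrite {1}SE addrK.
- by apply: half_contraction_fixpoint_uniq (SE _) _; rewrite subrK.
- have := A_half (S v); rewrite {2}SE.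
  by have := ler_rnormD v (A (S v)); rewrite -SE; lra.
Qed.

End neumann.

Section real_spectrum.
Context (R : realType) (V : completeNormedModType R[i]).
Variable H : operator V.

Lemma bounded_operatorP (B : V -> V) :
  bounded_operator B <-> exists M : R, 0 < M /\ forall v,
    rnorm (B v) <= M * rnorm v.
Proof.
split=> [[M BM]|[M [_ BM]]]; last first.
  by exists M => v; rewrite !rnormE -rmorphM /= lecR.
exists (`|M| + 1); split=> [|v]; first by rewrite ltr_wpDl.
have := BM v; rewrite !rnormE -rmorphM /= lecR => /le_trans; apply.
by rewrite ler_wpM2r ?rnorm_ge0// (le_trans (ler_norm _))// lerDl.
Qed.

(** With B the resolvent at x0, H - x = (1 - (x - x0) B) (H - x0). The radius 1 / (2 M) makes (x -
    x0) B a half-contraction, so B (1 - (x - x0) B)^-1 inverts H - x. *)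
Lemma open_real_resolvent : open [set x : R | resolvent_set H x%:C].
Proof.
rewrite openE => x0 [B [/bounded_operatorP[M [M0 BM]] HB BH]].
have M20 : 0 < (2 * M)^-1 by rewrite invr_gt0 mulr_gt0.
apply/nbhs_ballP; exists (2 * M)^-1 => //= x xx0.
pose w := (x - x0)%:C : R[i].
pose A : {linear V -> V} := (w \*: B).
have A_half v : rnorm (A v) <= 2^-1 * rnorm v.
  rewrite /A /= rnormZr.
  have -> : 2^-1 * rnorm v = (2 * M)^-1 * (M * rnorm v) by field;
    rewrite gt_eqF.
  by rewrite ler_pM ?rnorm_ge0// distrC ltW.
have [S [SA AS Sb]] := neumann_inverse A_half.
exists (B \o S); split.
- apply/bounded_operatorP; exists (M * 2); split=> [|v];
    first by rewrite mulr_gt0.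
  by rewrite /= (le_trans (BM _))// -mulrA ler_pM2l.
- move=> v /=; have [dB eB] := HB (S v); split => //.
  rewrite -[RHS]SA -[X in _ = X - _]eB /A /= -addrA -opprD -scalerDl;
    congr (_ - _ *: _).
  by rewrite -rmorphD /= addrC subrK.
- move=> u du /=.
  have <- : (H u - x0%:C *: u) - A (H u - x0%:C *: u) = H u - x%:C *: u.
    rewrite /A /= BH// -addrA -opprD -scalerDl; congr (_ - _ *: _).
    by rewrite -rmorphD /= addrC subrK.
  by rewrite AS BH.
Qed.

Lemma measurable_real_spectrum : measurable (real_spectrum H).
Proof.
rewrite (_ : real_spectrum H = ~` [set x : R | resolvent_set H x%:C]) //.
by apply: measurableC; exact: open_measurable open_real_resolvent.
Qed.

End real_spectrum.

(** * Bounded functional calculus of a projection-valued measure *)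

Section bounded_measurable.
Context (R : realType).
Implicit Types f g : R -> R.

Import HBNNSimple.

(** The integral is built from simple functions, whose level sets are Borel, so a set function
    enters only through its Borel values. This lets [scalar_measure] be replaced by a genuine
    measure. *)
Lemma eq_integral_on_measurable (m1 m2 : set R -> \bar R) (D : set R)
    (f : R -> \bar R) :
  (forall A, measurable A -> m1 A = m2 A) -> integral m1 D f = integral m2 D f.
Proof.
move=> m12; have sE h : measurable_fun setT h ->
  sintegral m1 h = sintegral m2 h.
  move=> mh; apply: eq_fsbigr => x _; rewrite m12//.
  by rewrite -[_ @^-1` _]setTI; apply: mh => //; exact: measurable_set1.
rewrite /integral; congr (ereal_sup _ - ereal_sup _)%E;
  by apply/seteqP; split=> x [h hf <-]; exists h => //; rewrite sE.
Qed.

Definition bounded_measurable f :=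
  measurable_fun setT f /\ exists M, forall x, `|f x| <= M.

Lemma bounded_measurable_cst r : bounded_measurable (fun=> r).
Proof. by split; [exact: measurable_cst|exists `|r|]. Qed.

Lemma bounded_measurableD f g : bounded_measurable f -> bounded_measurable g ->
  bounded_measurable (fun x => f x + g x).
Proof.
move=> [mf [M fM]] [mg [N gN]]; split; first exact: measurable_funD.
by exists (M + N) => x; rewrite (le_trans (ler_normD _ _))// lerD.
Qed.

Lemma bounded_measurableZ r f : bounded_measurable f ->
  bounded_measurable (fun x => r * f x).
Proof.
move=> [mf [M fM]]; split; first by apply: measurable_funM.
by exists (`|r| * M) => x; rewrite normrM ler_wpM2l.
Qed.

Lemma bounded_measurableB f g : bounded_measurable f -> bounded_measurable g ->
  bounded_measurable (fun x => f x - g x).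
Proof.
move=> [mf [M fM]] [mg [N gN]]; split; first exact: measurable_funB.
by exists (M + N) => x; rewrite (le_trans (ler_normB _ _))// lerD.
Qed.

Lemma bounded_measurable_norm f : bounded_measurable f ->
  bounded_measurable (fun x => `|f x|).
Proof.
move=> [mf [M fM]]; split; first exact: measurableT_comp.
by exists M => x; rewrite normr_id.
Qed.

Lemma bounded_measurable_max0 f : bounded_measurable f ->
  bounded_measurable (fun x => Num.max (f x) 0).
Proof.
move=> [mf [M fM]]; split; first exact: measurable_maxr.
exists M => x; rewrite (le_trans _ (fM x))//.
by case: (leP (f x) 0) => //; rewrite normr0.
Qed.

Lemma bounded_measurable_indic (A : set R) : measurable A ->
  bounded_measurable (\1_A : R -> R).
Proof.
move=> mA; split; first exact: measurable_indic.
by exists 1 => x; rewrite indicE; case: (_ \in _); rewrite ?normr1 ?normr0.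
Qed.

Lemma bounded_measurable_sum (I : Type) (s : seq I) (F : I -> R -> R) :
  (forall i, bounded_measurable (F i)) ->
  bounded_measurable (fun x => \sum_(i <- s) F i x).
Proof.
move=> bF; elim: s => [|i s ih].
  under eq_fun do rewrite big_nil; exact: bounded_measurable_cst.
by under eq_fun do rewrite big_cons; exact: bounded_measurableD.
Qed.

Lemma bounded_measurable_integrable (mu : {measure set R -> \bar R}) f :
  (mu setT < +oo)%E -> bounded_measurable f -> mu.-integrable setT (EFin \o f).
Proof.
move=> muT [mf [M fM]]; apply: measurable_bounded_integrable => //.
by exists M; split => [|N MN x _]; [exact: num_real|rewrite /= (le_trans (fM
  x))// ltW].
Qed.

Lemma cvg_Rintegral_bounded (mu : {measure set R -> \bar R})
    (f_ : nat -> R -> R) f (M : R) : (mu setT < +oo)%E ->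
  (forall n, measurable_fun setT (f_ n)) -> measurable_fun setT f ->
  (forall n x, `|f_ n x| <= M) -> (forall x, f_ ^~ x @ \oo --> f x) ->
  (fun n => \int[mu]_x f_ n x) @ \oo --> \int[mu]_x f x.
Proof.
move=> muT mf_ mf fM cf.
have iM : mu.-integrable setT (EFin \o cst M).
  by apply: bounded_measurable_integrable => //; exact: bounded_measurable_cst.
have [||||i_f _ cI] := @dominated_convergence _ _ _ mu setT measurableT
  (fun n => EFin \o f_ n) (EFin \o f) (EFin \o cst M) _ _ _ iM _.
- by move=> n; exact/measurable_EFinP.
- exact/measurable_EFinP.
- by apply: aeW => x _; apply: cvg_EFin; [exact: nearW|exact: cf].
- by apply: aeW => x n _; rewrite lee_fin.
by apply: fine_cvg; rewrite fineK// integrable_fin_num.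
Qed.

End bounded_measurable.

(** * Construction and norm bounds of f(H) for bounded Borel f *)

Section calculus.
Context (R : realType) (V : completeNormedModType R[i]).
Variable dot : {dot V for Num.conj}.
Hypothesis dotP : induces_norm dot.
Variable E : set R -> {linear V -> V}.
Hypothesis EP : projection_valued_measure dot E.
Import HBNNSimple.
Implicit Types (u v w : V) (f g : R -> R) (T S : {linear V -> V}).

(** Countable additivity for copies of the empty set gives a convergent series with constant term,
    so the term is 0. *)
Lemma pvm0 v : E set0 v = 0.
Proof.
have [_ _ _ /(_ (fun=> set0))] := EP.
move=> /(_ (fun=> measurable0)) /(_ (@trivIset_set0 _ _ _)) /(_ v).
rewrite bigcup0// => h.
have /cvg_series_cvg_0 c0 : cvg (series (fun n : nat => E set0 v) @ \oo).
  by apply/cvg_ex; exists (E set0 v).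
by apply: cvg_unique c0 => //; exact: cvg_cst.
Qed.

Lemma dot_pvm v A : measurable A -> dot (E A v) v = (rnorm (E A v) ^+ 2)%:C.
Proof.
have [EA _ _ _] := EP; move=> /EA[EE Es].
by rewrite -{1}EE Es dotP rnormE rmorphXn.
Qed.

(* [scalar_measure] is arbitrary, possibly negative, on sets that are not Borel;
   resetting it to 0 there gives a measure of the library without changing any
   integral. *)
Definition pvm_measure of induces_norm dot & projection_valued_measure dot E :=
  fun v A => if `[< measurable A >] then scalar_measure dot E v A else 0%E.

Local Notation mu := (pvm_measure dotP EP).

Lemma pvm_measureE v A : measurable A -> mu v A = (rnorm (E A v) ^+ 2)%:E.
Proof.
by move=> mA; rewrite /pvm_measure asboolT// /scalar_measure dot_pvm.
Qed.

Section pvm_measure_instance.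
Variable v : V.

Let mu0 : mu v set0 = 0%E.
Proof. by rewrite pvm_measureE// pvm0 rnorm0 expr0n. Qed.

Let mu_ge0 A : (0 <= mu v A)%E.
Proof.
rewrite /pvm_measure; case: asboolP => // mA.
by rewrite /scalar_measure dot_pvm// lee_fin sqr_ge0.
Qed.

Let mu_sigma_additive : semi_sigma_additive (mu v).
Proof.
move=> F mF tF mUF; have [_ _ _ /(_ F mF tF v) cF] := EP.
have rE A : measurable A -> mu v A = (rdot dot (E A v) v)%:E.
  by move=> mA; rewrite pvm_measureE// /rdot dot_pvm.
rewrite rE//; have -> : (fun n => \sum_(0 <= i < n) mu v (F i))%E =
    (fun n => (rdot dot (series (fun n => E (F n) v) n) v)%:E).
  apply/funext => n; rewrite /series /=.
  elim: n => [|n ih]; first by rewrite !big_geq// /rdot linear0l.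
  by rewrite !big_nat_recr//= ih rdotDl rE.
by apply: cvg_EFin; [exact: nearW|exact: rdotl_cvg].
Qed.

HB.instance Definition _ := isMeasure.Build _ R R (mu v)
  mu0 mu_ge0 mu_sigma_additive.

End pvm_measure_instance.

Lemma pvm_measureT v : mu v setT = (rnorm v ^+ 2)%:E.
Proof. by have [_ E1 _ _] := EP; rewrite pvm_measureE// E1. Qed.

Lemma pvm_measureT_lty v : (mu v setT < +oo)%E.
Proof. by rewrite pvm_measureT ltry. Qed.

Lemma pvm_integrable v f : bounded_measurable f -> 
  (mu v).-integrable setT (EFin \o f).
Proof. exact: bounded_measurable_integrable (pvm_measureT_lty v). Qed.

Hint Resolve pvm_integrable : core.

(* T = \int f dE: on a complex space the quadratic form determines T. *)
Definition is_calculus f T := forall v, dot (T v) v = (\int[mu v]_x f x)%:C.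

Lemma is_calculusD f g T S : bounded_measurable f -> bounded_measurable g ->
  is_calculus f T -> is_calculus g S ->
  is_calculus (fun x => f x + g x) (T \+ S).
Proof.
move=> bf bg fT gS v; rewrite RintegralD//; try exact: pvm_integrable.
by rewrite rmorphD /= -fT -gS -{1}[T v]scale1r dotDZl mul1r.
Qed.

Lemma is_calculusZ f T r : bounded_measurable f -> is_calculus f T ->
  is_calculus (fun x => r * f x) (r%:C \*: T).
Proof.
move=> bf fT v; rewrite RintegralZl//; last exact: pvm_integrable.
by rewrite rmorphM /= -fT dotZl.
Qed.

Lemma is_calculus_indic A : measurable A -> is_calculus \1_A (E A).
Proof.
move=> mA v; rewrite dot_pvm//; congr _%:C.
by rewrite /Rintegral integral_indic// setIT /= pvm_measureE.
Qed.

Lemma is_calculus_cst r : is_calculus (fun=> r) (r%:C \*: idfun).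
Proof.
move=> v; rewrite /= dotZl dotP rnormE Rintegral_cst// /= pvm_measureT /=.
by rewrite rmorphM rmorphXn.
Qed.

(** The measure of [v] has total mass |v|^2, so the form of T lies between 0 and C |v|^2 and
    [rnorm_pos_operator] applies. *)
Lemma is_calculus_pos f T (C : R) : bounded_measurable f ->
  (forall x, 0 <= f x <= C) -> 0 < C -> is_calculus f T ->
  forall v, rnorm (T v) ^+ 2 <= C * \int[mu v]_x f x.
Proof.
move=> bf f0C C0 fT; apply: rnorm_pos_operator => // v.
rewrite Rintegral_ge0/=; last by move=> x _; have /andP[] := f0C x.
have -> : C * rnorm v ^+ 2 = \int[mu v]_x (cst C) x.
  by rewrite Rintegral_cst// /= pvm_measureT.
apply: le_Rintegral => //; try apply: pvm_integrable => //.
  exact: bounded_measurable_cst.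
by move=> x _; have /andP[] := f0C x.
Qed.

(** T - S represents the function 0, which is positive with bound 1, so [is_calculus_pos] gives |(T
    - S) v|^2 <= 0. *)
Lemma is_calculus_uniq f T S : bounded_measurable f ->
  is_calculus f T -> is_calculus f S -> T =1 S.
Proof.
move=> bf fT fS v; have h : is_calculus (fun x =>
  f x + -1 * f x) (T \+ (-1)%:C \*: S).
  apply: is_calculusD => //; first exact: bounded_measurableZ.
  exact: is_calculusZ.
have b0 : bounded_measurable (fun x => f x + -1 * f x).
  by apply: bounded_measurableD => //; exact: bounded_measurableZ.
have := is_calculus_pos (C := 1) b0 _ _ h v.
have -> : (fun x => f x + -1 * f x) = cst 0.
  by apply/funext => x; rewrite mulN1r subrr.
rewrite Rintegral_cst// mul0r mulr0 => /(_ _ ltr01) h0.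
apply/eqP; rewrite -subr_eq0; apply/eqP/rnorm_eq0/eqP.
rewrite -sqrf_eq0 eq_le sqr_ge0 andbT -[X in rnorm X](_ : (T \+ (-1)%:C \*: S) v
  = _).
  by apply: h0 => x; rewrite mulN1r subrr lexx ler01.
by rewrite /= rmorphN rmorph1 scaleN1r.
Qed.

(** Serves twice: for simple functions, summed over their values, and for Riemann sums, summed over
    the subintervals. *)
Lemma is_calculus_sum (I : Type) (s : seq I) (F : I -> R -> R)
    (T : I -> {linear V -> V}) :
  (forall i, bounded_measurable (F i)) -> (forall i, is_calculus (F i) (T i)) ->
  exists S, is_calculus (fun x => \sum_(i <- s) F i x) S /\
            forall v, S v = \sum_(i <- s) T i v.
Proof.
move=> bF FT; elim: s => [|i s [S [ih SE]]].
  exists (0%:C \*: idfun); split=> [|v]; last by rewrite big_nil /= scale0r.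
  under eq_fun do rewrite big_nil; exact: is_calculus_cst.
exists (T i \+ S); split=> [|v]; last by rewrite big_cons /= SE.
under eq_fun do rewrite big_cons.
by apply: is_calculusD => //; exact: bounded_measurable_sum.
Qed.

Lemma is_calculus_simple (g : {nnsfun R >-> R}) : exists T, is_calculus g T.
Proof.
have bF y : bounded_measurable (fun x => y * \1_(g @^-1` [set y]) x).
  exact/bounded_measurableZ/bounded_measurable_indic.
have FT y : is_calculus (fun x => y * \1_(g @^-1` [set y]) x)
    (y%:C \*: E (g @^-1` [set y])).
  apply: is_calculusZ; first exact: bounded_measurable_indic.
  exact: is_calculus_indic.
have [T [gT _]] := is_calculus_sum (finmap.enum_fset (fset_set (range g))) bF
  FT.
exists T; rewrite (_ : (g : R -> R) = (fun x =>
  \sum_(y <- finmap.enum_fset (fset_set (range g))) (y * \1_(g @^-1` [set y])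
    x)))//.
by apply/funext => x; rewrite fimfunE fsbig_finite.
Qed.

(* For simple functions g_n increasing to f, the operators T_n = \int g_n dE
   satisfy |(T_n - T_m) v|^2 <= C \int (g_n - g_m) dmu_v, hence converge
   strongly. *)
Lemma is_calculus_ex_pos f (C : R) : measurable_fun setT f ->
  (forall x, 0 <= f x <= C) -> 0 < C -> exists T, is_calculus f T.
Proof.
move=> mf f0C C0.
have f0 x : 0 <= f x by have /andP[] := f0C x.
have mf' : measurable_fun setT (EFin \o f) by exact/measurable_EFinP.
pose g := nnsfun_approx measurableT mf'.
have gf x : (fun n => g n x) @ \oo --> f x.
  have := cvg_nnsfun_approx measurableT mf' (fun x _ => f0 x) (x := x) I.
  by move/fine_cvg.
have gnd m n x : (m <= n)%N -> g m x <= g n x.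
  by move=> mn; have /lefP := nd_nnsfun_approx measurableT mf' mn; apply.
have gleC n x : g n x <= C.
  have /andP[_] := f0C x; apply: le_trans.
  rewrite -(cvg_lim (@Rhausdorff R) (gf x)).
  apply: nondecreasing_cvgn_le; first by move=> m p; exact: gnd.
  by apply/cvg_ex; exists (f x).
have bg n : bounded_measurable (g n).
  by split => //; exists C => x; rewrite ger0_norm.
have [T gT] := choice (fun n => is_calculus_simple (g n)).
have cI v : (fun n => \int[mu v]_x g n x) @ \oo --> \int[mu v]_x f x.
  apply: cvg_Rintegral_bounded (pvm_measureT_lty v) _ mf _ (gf) => // n x.
  by rewrite ger0_norm.
have Tmn m n v : (m <= n)%N ->
    rnorm (T n v - T m v) ^+ 2 <=
    C * (\int[mu v]_x g n x - \int[mu v]_x g m x).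
  move=> mn.
  have h : is_calculus (fun x => g n x + -1 * g m x) (T n \+ (-1)%:C \*: T m).
    apply: is_calculusD => //; first exact: bounded_measurableZ.
    exact: is_calculusZ.
  have b : bounded_measurable (fun x => g n x + -1 * g m x).
    by apply: bounded_measurableD => //; exact: bounded_measurableZ.
  have := is_calculus_pos (C := C) b _ C0 h v.
  rewrite /= rmorphN rmorph1 scaleN1r RintegralD ?RintegralZl ?mulN1r//;
    try exact: pvm_integrable.
    apply => x; rewrite mulN1r subr_ge0 gnd//=.
    by rewrite lerBlDr (le_trans (gleC n x))// lerDl.
  by apply: pvm_integrable; exact: bounded_measurableZ.
have cT v : exists l : V, (fun n => T n v) @ \oo --> l.
  apply: rnorm_cauchy_cvg => e e0.
  (* Two integrals this close to the limit differ by less than e^2 / (4 C), which the factor C in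
     [Tmn] turns into (e / 2)^2. *)
  have d0 : 0 < e ^+ 2 / (8 * C) by rewrite divr_gt0 ?exprn_gt0 ?mulr_gt0.
  have /cvgrPdist_lt /(_ _ d0) [N _ Nh] := cI v.
  have cN n : (N <= n)%N -> rnorm (T n v - T N v) < e / 2.
    move=> Nn; have := Nh _ Nn; have := Nh _ (leqnn N).
    rewrite /= !ltr_norml => /andP[h1 h2] /andP[h3 h4].
    have e20 : 0 <= e / 2 by rewrite divr_ge0// ltW.
    rewrite -(@ltr_pXn2r _ 2)// ?nnegrE ?rnorm_ge0//.
    apply: le_lt_trans (Tmn _ _ v Nn) _.
    have -> : (e / 2) ^+ 2 = C * (2 * (e ^+ 2 / (8 * C))) by field;
      rewrite gt_eqF.
    by rewrite ltr_pM2l//; move: h2 h3; clear; lra.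
  exists N => m n /cN Nm /cN Nn; rewrite -(subrKA (T N v)).
  rewrite (le_lt_trans (ler_rnormD _ _))// (rnormBC (T N v)).
  by move: Nm Nn; clear; lra.
have [L cL] := choice cT.
have Llin : linear L.
  move=> c u v; apply: cvg_unique (cL _) _ => //.
  rewrite (_ : (fun n => _) = (fun n => c *: T n u + T n v)).
    by apply: cvgD; [apply: cvgZr; exact: cL|exact: cL].
  by apply/funext => n; rewrite linearP.
pose L' : {linear V -> V} := HB.pack L (GRing.isLinear.Build R[i] V V _ L Llin).
exists L' => v /=; apply/eqP; rewrite eq_complex /=.
have Tre : (fun n => rdot dot (T n v) v) @ \oo --> rdot dot (L v) v.
  by apply: rdotl_cvg => //; exact: cL.
(* [rdotl_cvg] controls real parts only; the imaginary part of the form is the real part after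
   multiplication by -i. *)
have Tim : (fun n => rdot dot ((- 'i) *: T n v) v) @ \oo -->
  rdot dot ((- 'i) *: L v) v.
  by apply: rdotl_cvg => //; apply: cvgZr; exact: cL.
have ImE z : complex.Re (- 'i * z) = complex.Im z :> R.
  by case: z => x y /=; rewrite mulN1r oppr0 mul0r sub0r opprK.
apply/andP; split; apply/eqP.
- have TreE : (fun n => rdot dot (T n v) v) = (fun n => \int[mu v]_x g n x).
    by apply/funext => n; rewrite /rdot gT.
  by rewrite TreE in Tre; apply: cvg_unique Tre (cI v).
- rewrite -ImE -dotZl.
  have TimE : (fun n => rdot dot (- 'i *: T n v) v) = cst 0.
    by apply/funext => n; rewrite /rdot dotZl ImE gT.
  by rewrite TimE in Tim; apply: cvg_unique Tim (cvg_cst _).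
Qed.

Lemma is_calculus_ex f : bounded_measurable f -> exists T, is_calculus f T.
Proof.
move=> bf; have [mf [M fM]] := bf.
(* Adding N makes the function positive with bound 2 N; N times the identity is subtracted
   afterwards. *)
pose N := `|M| + 1; have N0 : 0 < N by rewrite ltr_wpDl.
have fN x : `|f x| <= N.
  by rewrite (le_trans (fM x))// (le_trans (ler_norm _))// lerDl.
have [T fT] : exists T, is_calculus (fun x => f x + N) T.
  apply: (@is_calculus_ex_pos _ (2 * N)); rewrite ?mulr_gt0//.
    exact: measurable_funD.
  move=> x; have := fN x; rewrite ler_norml => /andP[h1 h2].
  by apply/andP; split; lra.
exists (T \+ (- N)%:C \*: idfun).
rewrite (_ : f = (fun x => (f x + N) + - N)); last first.
  by apply/funext => x; rewrite addrK.
apply: is_calculusD => //; last exact: is_calculus_cst.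
  by apply: bounded_measurableD => //; exact: bounded_measurable_cst.
exact: bounded_measurable_cst.
Qed.

(** Split f into positive and negative parts p and n, with operators P and N. The factor 2 is that
    of |P v - N v|^2 <= 2 (|P v|^2 + |N v|^2), and p + n = |f|. *)
Lemma is_calculus_bound f T (C : R) : bounded_measurable f ->
  (forall x, `|f x| <= C) -> 0 < C -> is_calculus f T ->
  forall v, rnorm (T v) ^+ 2 <= 2 * C * \int[mu v]_x `|f x|.
Proof.
move=> bf fC C0 fT v.
have bN : bounded_measurable (fun x => - f x).
  under eq_fun do rewrite -mulN1r; exact: bounded_measurableZ.
pose p x := Num.max (f x) 0; pose n x := Num.max (- f x) 0.
have bp : bounded_measurable p by exact: bounded_measurable_max0.
have bn : bounded_measurable n by exact: bounded_measurable_max0.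
have [P pP] := is_calculus_ex bp; have [N nN] := is_calculus_ex bn.
have p0 x : 0 <= p x <= C.
  have := fC x; rewrite /p ler_norml => /andP[h1 h2].
  by case: (leP _ 0) => h; apply/andP; split; lra.
have n0 x : 0 <= n x <= C.
  have := fC x; rewrite /n ler_norml => /andP[h1 h2].
  by case: (leP _ 0) => h; apply/andP; split; lra.
have -> : T v = P v - N v.
  have -> : P v - N v = (P \+ (-1)%:C \*: N) v.
    by rewrite /= rmorphN rmorph1 scaleN1r.
  apply: is_calculus_uniq bf fT _ v.
  rewrite (_ : f = (fun x => p x + -1 * n x)).
    apply: is_calculusD => //; first exact: bounded_measurableZ.
    exact: is_calculusZ.
  by apply/funext => x; rewrite /p /n; case: (leP (f x) 0) => ?;
    case: (leP (- f x) 0) => ?; lra.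
rewrite (_ : (fun x => `|f x|) = (fun x => p x + n x)); last first.
  apply/funext => x; rewrite /p /n.
  by case: (ger0P (f x)) => ?; case: (leP (f x) 0) => ?;
    case: (leP (- f x) 0) => ?; lra.
rewrite RintegralD//; try exact: pvm_integrable.
have := is_calculus_pos bp p0 C0 pP v; have := is_calculus_pos bn n0 C0 nN v.
have := ler_rnormB (P v) (N v).
have := rnorm_ge0 (P v - N v); have := rnorm_ge0 (P v); have := rnorm_ge0 (N v).
set x := rnorm (P v - N v); set y := rnorm (P v); set z := rnorm (N v).
set a := Rintegral _ _ _; set b := Rintegral _ _ _ => z0 y0 x0 xyz za yb.
have : x ^+ 2 <= (y + z) ^+ 2 by rewrite ler_sqr ?nnegrE ?addr_ge0.
have := sqr_ge0 (y - z); rewrite sqrrB sqrrD; lra.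
Qed.

(** Operator-norm bound used for Riemann sums; the integral of |f| is at most C |v|^2, and 2 C^2 <=
    (2 C)^2. *)
Lemma is_calculus_sup f T (C : R) : bounded_measurable f ->
  (forall x, `|f x| <= C) -> 0 < C -> is_calculus f T ->
  forall v, rnorm (T v) <= 2 * C * rnorm v.
Proof.
move=> bf fC C0 fT v; have := is_calculus_bound bf fC C0 fT v.
have : \int[mu v]_x `|f x| <= C * rnorm v ^+ 2.
  have -> : C * rnorm v ^+ 2 = \int[mu v]_x (cst C) x.
    by rewrite Rintegral_cst// /= pvm_measureT.
  apply: le_Rintegral => //; try apply: pvm_integrable.
    exact: bounded_measurable_norm.
  exact: bounded_measurable_cst.
move=> h1 h2; rewrite -ler_sqr ?nnegrE ?mulr_ge0 ?rnorm_ge0 ?(ltW C0)//.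
apply: (le_trans h2); apply: (@le_trans _ _ (2 * C * (C * rnorm v ^+ 2))).
  by rewrite ler_wpM2l// mulr_ge0// ltW.
rewrite !exprMn; have := sqr_ge0 (C * rnorm v); rewrite exprMn; lra.
Qed.

End calculus.

(** * The rational kernel and its primitive *)

Section logarithmic_ratio.
Context (R : realType).
Implicit Types p q x : R.

(** The logarithms in the primitive are unbounded one by one. As their coefficients sum to 0, the
    common term ln (x^2 + 1) may be subtracted from each, which leaves bounded functions vanishing
    at infinity. *)
Definition log_ratio p q x := ln (((x - p) ^+ 2 + q ^+ 2) / (x ^+ 2 + 1)).

Let den_gt0 x : 0 < x ^+ 2 + 1.
Proof. by rewrite ltr_wpDl// sqr_ge0. Qed.

Lemma sqrBD_sqr_gt0 p q x : 0 < q -> 0 < (x - p) ^+ 2 + q ^+ 2.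
Proof. by move=> q0; rewrite ltr_wpDl ?sqr_ge0// exprn_gt0. Qed.

Lemma log_ratioE p q x : 0 < q ->
  log_ratio p q x = ln ((x - p) ^+ 2 + q ^+ 2) - ln (x ^+ 2 + 1).
Proof. by move=> q0; rewrite /log_ratio ln_div// posrE// sqrBD_sqr_gt0. Qed.

Lemma ln_le_sub1 x : 0 < x -> ln x <= x - 1.
Proof.
move=> x0; have := @le_ln1Dx R (x - 1).
by rewrite (addrC 1) subrK ltrBrDr addNr; exact.
Qed.

Lemma log_ratio_bounded p q : 0 < q -> exists M, forall x,
  `|log_ratio p q x| <= M.
Proof.
(* M1 bounds the ratio by (x - p)^2 <= 2 x^2 + 2 p^2, M2 its inverse by x^2 <= 2 (x - p)^2 + 2 p^2;
   then ln t <= t - 1 is applied to both. *)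
move=> q0; pose M1 := 2 + 2 * p ^+ 2 + q ^+ 2.
pose M2 := 2 + (2 * p ^+ 2 + 1) / q ^+ 2; exists (M1 + M2) => x.
have q20 : 0 < q ^+ 2 by rewrite exprn_gt0.
have n0 := sqrBD_sqr_gt0 p x q0; have d0 := den_gt0 x.
have p0 := sqr_ge0 p; have x0 := sqr_ge0 x; have xp0 := sqr_ge0 (x - p).
have M10 : 0 <= M1 by rewrite /M1 ; lra.
have M20 : 0 <= M2 by rewrite /M2 addr_ge0// divr_ge0 ?ltW//; lra.
rewrite ler_norml; apply/andP; split.
- rewrite lerNl /log_ratio -lnV ?posrE ?divr_gt0//.
  rewrite (le_trans (ln_le_sub1 _)) ?invr_gt0 ?divr_gt0//.
  suff : (((x - p) ^+ 2 + q ^+ 2) / (x ^+ 2 + 1))^-1 <= M2 by lra.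
  rewrite invf_div ler_pdivrMr//.
  have -> : M2 * ((x - p) ^+ 2 + q ^+ 2) = 2 * (x - p) ^+ 2 + 2 * q ^+ 2 +
     (2 * p ^+ 2 + 1) * (x - p) ^+ 2 / q ^+ 2 + (2 * p ^+ 2 + 1).
    by rewrite /M2; field; rewrite gt_eqF.
  have h1 : 0 <= (2 * p ^+ 2 + 1) * (x - p) ^+ 2 / q ^+ 2.
    by rewrite divr_ge0 ?(ltW q20)// mulr_ge0//; lra.
  have h2 : 0 <= (x - 2 * p) ^+ 2 by rewrite sqr_ge0.
  by move: h1; set z := _ / _; nra.
- rewrite /log_ratio (le_trans (ln_le_sub1 _)) ?divr_gt0//.
  suff : ((x - p) ^+ 2 + q ^+ 2) / (x ^+ 2 + 1) <= M1 by lra.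
  rewrite ler_pdivrMr// /M1.
  have : 0 <= (x + p) ^+ 2 by rewrite sqr_ge0.
  have : 0 <= q ^+ 2 * x ^+ 2 by rewrite mulr_ge0// ltW.
  have : 0 <= p ^+ 2 * x ^+ 2 by rewrite mulr_ge0.
  by nra.
Qed.

Lemma log_ratio_infty p q e : 0 < q -> 0 < e ->
  exists N, forall x, N < `|x| -> `|log_ratio p q x| < e.
Proof.
move=> q0 e0.
have /cvgrPdist_lt /(_ _ e0) := @continuous_ln R 1 ltr01.
rewrite ln1 => /nbhs_ballP[d /= d0 dln].
(* For |x| > 1 the numerator 2 p x - (p^2 + q^2 - 1) is at most D |x| in modulus, so the ratio is
   within d of 1 once |x| > D / d. *)
pose D := 2 * `|p| + `|p ^+ 2 + q ^+ 2 - 1|.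
exists (Num.max 1 (D / d)) => x; rewrite gt_max => /andP[x1 xD].
have d0' := den_gt0 x.
rewrite -normrN -[X in `|X|]add0r; apply: dln; rewrite /ball /=.
have -> : 1 - ((x - p) ^+ 2 + q ^+ 2) / (x ^+ 2 + 1) =
    (2 * p * x - (p ^+ 2 + q ^+ 2 - 1)) / (x ^+ 2 + 1).
  by field; rewrite gt_eqF.
rewrite normrM normfV (gtr0_norm d0') ltr_pdivrMr//.
rewrite (le_lt_trans (ler_normB _ _))// !normrM (ger0_norm (ler0n _ 2)).
move: xD; rewrite ltr_pdivrMr// -[x ^+ 2]real_normK ?num_real// /D.
have := normr_ge0 p; have := normr_ge0 (p ^+ 2 + q ^+ 2 - 1).
move: (`|p|) (`|x|) x1 (`|_ - 1|) => r y y1 c c0 r0 h.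
have y0 : 0 < y by rewrite (lt_trans _ y1).
have : (2 * r + c) * y < y * d * y by rewrite ltr_pM2r.
have : c <= c * y by rewrite ler_peMr// ltW.
by move: d0; clear; lra.
Qed.

End logarithmic_ratio.

(** * Uniqueness for the transposed Vandermonde system *)

Section vandermonde.
Context (F : fieldType) (m : nat) (a : 'I_m -> F).
Hypothesis a_inj : injective a.

(** The functional p |-> \sum_j d j * p(a j) kills all polynomials of degree below m; test it on the
    one whose roots are all nodes but a j0. *)
Lemma moments_inj (d : 'I_m -> F) :
  (forall k, (k < m)%N -> \sum_(j < m) d j * a j ^+ k = 0) -> forall j, d j = 0.
Proof.
move=> d0 j0.
have dp (p : {poly F}) : (size p <= m)%N -> \sum_(j < m) d j * p.[a j] = 0.
  move=> pm; under eq_bigr do rewrite (horner_coef_wide _ pm) mulr_sumr.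
  rewrite exchange_big big1//= => i _.
  under eq_bigr do rewrite mulrCA.
  by rewrite -mulr_sumr d0 ?mulr0.
pose s := [seq a i | i <- enum (predC1 j0)].
have [p sp rp] : exists2 p : {poly F}, (size p <= m)%N & forall x,
  root p x = (x \in s).
  exists (\prod_(z <- s) ('X - z%:P)) => [|x]; last by rewrite root_prod_XsubC.
  (* The m - 1 roots give degree m - 1, that is size m, the largest that the moments reach. *)
  rewrite size_prod_XsubC size_map -cardE cardC1 card_ord.
  by rewrite ltn_predL (leq_ltn_trans _ (ltn_ord j0)).
have := dp _ sp; rewrite (bigD1 j0)//= big1 ?addr0 => [|j jj0].
  move=> /eqP; rewrite mulf_eq0 => /orP[/eqP//|].
  rewrite -/(root _ _) rp => s_aj0; have [k] := mapP s_aj0.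
  by rewrite mem_enum inE /= => /eqP kj0 /a_inj /esym.
suff /rootP -> : root p (a j) by rewrite mulr0.
by rewrite rp map_f// mem_enum inE.
Qed.

End vandermonde.

(** * The kernel as a real function, its primitive and the end-point constants *)

Section kernel.
Context (R : realType) (m : nat) (a alpha : 'I_m -> R[i]).
Hypothesis a_upper : forall j, 0 < complex.Im (a j).
Hypothesis alpha_sum : \sum_(j < m) alpha j = 1.

Let pi_neq0 : pi != 0 :> R.
Proof. by rewrite gt_eqF// pi_gt0. Qed.

Definition real_kernel (x : R) : R :=
  pi^-1 * complex.Im (\sum_(j < m) alpha j / (x%:C - a j)).

(** For real x the second sum is the conjugate of the first, and w - conj w = 2 i Im w. The calculus
    of real functions thus suffices. *)
Lemma rational_kernelE x : rational_kernel a alpha x = (real_kernel x)%:C.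
Proof.
rewrite /rational_kernel /real_kernel.
have -> : \sum_(j < m) Num.conj (alpha j) / (x%:C - Num.conj (a j)) =
    Num.conj (\sum_(j < m) alpha j / (x%:C - a j)).
  rewrite rmorph_sum; apply: eq_bigr => j _.
  rewrite rmorphM fmorphV rmorphB /=; congr (_ / (_ - _)).
  by rewrite -[RHS]/(conjc _) conjc_real.
rewrite -mulrBr -[Num.conj _]/(conjc _) subcJ -complexiE rmorphM fmorphV.
have i0 : Complex 0 1 != 0 :> R[i] by rewrite -normr_gt0 normc_def /= expr0n
  expr1n add0r sqrtr1.
have p0 : pi%:C != 0 :> R[i] by rewrite -[0]/(0%:C) (inj_eq (@complexI R))
  gt_eqF// pi_gt0.
have fE (P I X : R[i]) : P != 0 -> I != 0 -> (2 * P * I)^-1 * (2 * X * I) = P^-1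
  * X.
  by move=> P0 I0; field; rewrite P0 I0.
exact: fE.
Qed.

Lemma Im_le_cmod_sub (x : R) (z : R[i]) : 0 < complex.Im z ->
  complex.Im z <= cmod (x%:C - z).
Proof.
move=> z0; apply: le_trans (normr_Im_le _); case: z z0 => u v /= v0.
by rewrite sub0r normrN ger0_norm// ltW.
Qed.

(** On the real line |x - a j| >= Im (a j), which bounds both denominators in the difference of two
    values. *)
Lemma real_kernel_lipschitz : exists L, 0 < L /\
  forall x y, `|real_kernel x - real_kernel y| <= L * `|x - y|.
Proof.
pose L := pi^-1 * \sum_(j < m) (cmod (alpha j) / complex.Im (a j) ^+ 2).
have pi0 : 0 < (pi : R)^-1 by rewrite invr_gt0 pi_gt0.
have L0 : 0 <= L.
  rewrite mulr_ge0 ?(ltW pi0)// sumr_ge0// => j _.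
  by rewrite divr_ge0 ?cmod_ge0// sqr_ge0.
exists (L + 1); split=> [|x y]; first by rewrite ltr_wpDl.
apply: (@le_trans _ _ (L * `|x - y|)); last by rewrite ler_wpM2r// lerDl.
rewrite /real_kernel -mulrBr normrM (gtr0_norm pi0) -mulrA ler_pM2l//.
rewrite -raddfB -sumrB /= raddf_sum mulr_suml (le_trans (ler_norm_sum _ _ _))//.
apply: ler_sum => j _; rewrite (le_trans (normr_Im_le _))//.
have q0 := a_upper j.
have ne (z : R) := Im_le_cmod_sub z q0.
have nz (z : R) : z%:C - a j != 0 by rewrite -cmod_gt0 (lt_le_trans q0).
have -> : alpha j / (x%:C - a j) - alpha j / (y%:C - a j) =
    alpha j * (y - x)%:C / ((x%:C - a j) * (y%:C - a j)).
  by rewrite rmorphB /=; field; rewrite !nz.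
rewrite !cmodM cmodV cmodM cmod_real distrC mulrAC ler_wpM2r//.
rewrite ler_wpM2l ?cmod_ge0// lef_pV2 ?posrE ?mulr_gt0 ?exprn_gt0 ?cmod_gt0//.
by rewrite expr2 ler_pM// ltW.
Qed.

Lemma real_kernel_bounded : exists M, forall x, `|real_kernel x| <= M.
Proof.
exists (pi^-1 * \sum_(j < m) (cmod (alpha j) / complex.Im (a j))) => x.
have pi0 : 0 < (pi : R)^-1 by rewrite invr_gt0 pi_gt0.
rewrite /real_kernel normrM (gtr0_norm pi0) ler_pM2l//.
rewrite raddf_sum (le_trans (ler_norm_sum _ _ _))//; apply: ler_sum => j _.
have q0 := a_upper j; have ne := Im_le_cmod_sub x q0.
rewrite (le_trans (normr_Im_le _))// cmodM cmodV ler_wpM2l ?cmod_ge0//.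
by rewrite lef_pV2 ?posrE// (lt_le_trans q0).
Qed.

(** With alpha = b + i g and a = p + i q, Im (alpha / (x - a)) = (b q + g (x - p)) / ((x - p)^2 +
    q^2), integrated termwise. The moment of order 0 makes the limits -1/2 and 1/2 without a further
    constant. *)
Definition kernel_primitive (x : R) : R :=
  pi^-1 * \sum_(j < m)
    (complex.Re (alpha j) * atan ((x - complex.Re (a j)) / complex.Im (a j)) +
     complex.Im (alpha j) *
       (ln ((x - complex.Re (a j)) ^+ 2 + complex.Im (a j) ^+ 2) / 2)).

Lemma is_derive_kernel_primitive (x : R) :
  is_derive x (1 : R) kernel_primitive (real_kernel x).
Proof.
pose h j (x : R) := complex.Re (alpha j) * atan ((x - complex.Re (a j)) /
  complex.Im (a j)) +
     complex.Im (alpha j) *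
       (ln ((x - complex.Re (a j)) ^+ 2 + complex.Im (a j) ^+ 2) / 2).
rewrite (_ : kernel_primitive = pi^-1 *: \sum_(j < m) h j); last first.
  by apply/funext => y; rewrite /kernel_primitive /= fct_sumE.
apply: is_deriveZ; rewrite raddf_sum /=; apply: is_derive_sum => j.
have q0 := a_upper j.
rewrite /h; case: (alpha j) => b g; case: (a j) q0 => p q /= q0.
have n0 := sqrBD_sqr_gt0 p x q0.
have dl := is_derive1_ln n0.
apply: is_derive_eq.
rewrite /GRing.scale /= !sub0r.
by field; rewrite sqrrN !gt_eqF//; move: n0; rewrite sqrrB; nra.
Qed.

Lemma kernel_primitive_MVT x y : x <= y -> exists2 c, x <= c <= y &
  kernel_primitive y - kernel_primitive x = real_kernel c * (y - x).
Proof.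
move=> xy; have [] := @MVT_segment R kernel_primitive real_kernel x y xy.
- by move=> z _; exact: is_derive_kernel_primitive.
- apply: continuous_subspaceT => z; apply: differentiable_continuous.
  apply/derivable1_diffP; have h := is_derive_kernel_primitive z.
  exact: ex_derive.
by move=> c; rewrite in_itv /= => cxy e; exists c.
Qed.

Lemma Re_alpha_sum : \sum_(j < m) complex.Re (alpha j) = 1.
Proof. by have /(congr1 (@complex.Re R)) := alpha_sum; rewrite raddf_sum. Qed.

Lemma Im_alpha_sum : \sum_(j < m) complex.Im (alpha j) = 0.
Proof. by have /(congr1 (@complex.Im R)) := alpha_sum; rewrite raddf_sum. Qed.

Lemma kernel_primitiveE x : kernel_primitive x = pi^-1 * \sum_(j < m)
  (complex.Re (alpha j) * atan ((x - complex.Re (a j)) / complex.Im (a j)) +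
   complex.Im (alpha j) * (log_ratio (complex.Re (a j)) (complex.Im (a j)) x /
     2)).
Proof.
have g0 : \sum_(j < m) (complex.Im (alpha j) * (ln (x ^+ 2 + 1) / 2)) = 0.
  by rewrite -mulr_suml Im_alpha_sum mul0r.
rewrite /kernel_primitive; congr (_ * _);
  rewrite -[LHS]subr0 -[X in _ - X]g0 -sumrB.
by apply: eq_bigr => j _; rewrite log_ratioE//; ring.
Qed.

Lemma kernel_primitive_bounded : exists M, forall x, `|kernel_primitive x| <= M.
Proof.
have [M ML] := choice (fun j => log_ratio_bounded (complex.Re (a j)) (a_upper
  j)).
exists (pi^-1 * \sum_(j < m) (`|complex.Re (alpha j)| * (pi / 2) +
   `|complex.Im (alpha j)| * (M j / 2))) => x.
rewrite kernel_primitiveE normrM gtr0_norm ?invr_gt0 ?pi_gt0//.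
rewrite ler_wpM2l ?invr_ge0 ?pi_ge0// (le_trans (ler_norm_sum _ _ _))//.
apply: ler_sum => j _; rewrite (le_trans (ler_normD _ _))// lerD// normrM
  ler_wpM2l//.
  by rewrite ler_norml !ltW// ?atan_gtNpi2 ?atan_ltpi2.
by rewrite normrM [X in _ * X]ger0_norm// ler_wpM2r.
Qed.

(** The sign s treats both ends at once: atan is odd, and the log ratios vanish as |x| grows. *)
Lemma cvg_kernel_primitive (T : Type) (F : set_system T) {FF : Filter F}
    (f : T -> R) (s : R) : f @ F --> +oo -> `|s| = 1 ->
  (kernel_primitive (s * f x)) @[x --> F] --> s / 2.
Proof.
move=> foo s1.
have -> : s / 2 = pi^-1 * \sum_(j < m) (complex.Re (alpha j) * (s * (pi / 2)) +
    complex.Im (alpha j) * (0 / 2)).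
  under eq_bigr do rewrite mul0r mulr0 addr0.
  by rewrite -mulr_suml Re_alpha_sum mul1r mulrCA mulKf.
under eq_fun do rewrite kernel_primitiveE.
apply: cvgMr; apply: cvg_big => // [|j _]; first exact: add_continuous.
apply: cvgD; apply: cvgMr.
- rewrite (_ : (fun x => _) =
    (fun x => s * atan ((f x - s * complex.Re (a j)) / complex.Im (a j)))).
    apply: cvgMr; apply: cvg_comp (@cvgy_atan R).
    apply/cvgryPge => A.
    move/cvgryPge : foo => /(_ (A * complex.Im (a j) + s * complex.Re (a j))).
    by apply: filterS => x; rewrite ler_pdivlMr// lerBrDr.
  apply/funext => x; have : s = 1 \/ s = -1.
    by move: s1; case: (ger0P s) => _ => [->|/eqP];
      [left|rewrite eqr_oppLR => /eqP; right].
  case=> ->; first by rewrite !mul1r.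
  by rewrite !mulN1r -atanN; congr atan; rewrite opprK -mulNr opprD.
- apply: cvgMl; apply/cvgrPdist_lt => e e0.
  have [N NL] := log_ratio_infty (complex.Re (a j)) (a_upper j) e0.
  move/cvgryPgt : foo => /(_ N); apply: filterS => x Nx.
  by rewrite sub0r normrN; apply: NL; rewrite normrM s1 mul1r (lt_le_trans Nx)//
    ler_norm.
Qed.

(** With t = atan (Re z / Im z), cos (pi / 2 - t) = sin t = tan t * cos t = Re z / |z|, and pi / 2 -
    t lies where acos inverts cos. This form exhibits the atan term of the primitive at 0. *)
Lemma cargE (z : R[i]) : 0 < complex.Im z ->
  carg z = pi / 2 + atan (- complex.Re z / complex.Im z).
Proof.
move=> z0; rewrite /carg (ltW z0).
rewrite mulNr atanN; set t := atan _.
have tl := atan_gtNpi2 (complex.Re z / complex.Im z).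
have tr := atan_ltpi2 (complex.Re z / complex.Im z).
rewrite -[RHS]cosK ?in_itv/=; last first.
  by rewrite -/t in tl tr; apply/andP; split; lra.
congr acos; rewrite cosD cosN sinN cos_pihalf sin_pihalf mul0r mul1r sub0r
  opprK.
have ct : cos t != 0 by rewrite cos_atan invr_eq0 gt_eqF// sqrtr_gt0 ltr_wpDr//
  sqr_ge0.
rewrite -[sin t](divfK ct) -[_ / cos t]/(tan t) atanK cos_atan.
rewrite -mulrA; congr (_ * _).
have -> : cmod z = complex.Im z * Num.sqrt (1 + (complex.Re z / complex.Im z) ^+
  2).
  rewrite -[X in X * _](gtr0_norm z0) -sqrtr_sqr -sqrtrM ?sqr_ge0//.
  rewrite /cmod normc_def /=; congr Num.sqrt.
  by field; rewrite gt_eqF.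
by rewrite invfM.
Qed.

Lemma ln_cmod (z : R[i]) : 0 < cmod z ->
  ln (cmod z) = ln (complex.Re z ^+ 2 + complex.Im z ^+ 2) / 2.
Proof. by move=> z0; rewrite -cmod_sqr lnXn// -[_ *+ 2]mulr_natr mulfK. Qed.

Lemma cmod_upper_gt0 (z : R[i]) : 0 < complex.Im z -> 0 < cmod z.
Proof. by move=> /lt_le_trans; apply; rewrite (le_trans (ler_norm _))//
  normr_Im_le. Qed.

Lemma c_rightE : c_right a alpha = 1 / 2 + kernel_primitive 0.
Proof.
have -> : 1 / 2 = pi^-1 * \sum_(j < m) (complex.Re (alpha j) * (pi / 2)) :> R.
  by rewrite -mulr_suml Re_alpha_sum !mul1r mulKf.
rewrite /c_right /kernel_primitive -mulrDr -big_split /=; congr (_ * _).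
apply: eq_bigr => j _; rewrite cargE// ln_cmod ?cmod_upper_gt0// !sub0r sqrrN.
by rewrite mulrDr addrA.
Qed.

Lemma c_leftE : c_left a alpha = 1 / 2 - kernel_primitive 0.
Proof.
suff : c_left a alpha + c_right a alpha = 1 by rewrite c_rightE; lra.
rewrite /c_left /c_right -mulrDr -big_split /=.
under eq_bigr => j _ do rewrite addrACA -mulrDr subrK addNr addr0.
by rewrite -mulr_suml Re_alpha_sum mul1r mulVf// gt_eqF ?pi_gt0.
Qed.

(** The reversed conjugate coefficients have moments (-1)^k times the conjugates of those of alpha,
    hence again 1, 0, ..., 0; conclude by uniqueness. *)
Lemma alpha_rev_ord : injective a ->
  (forall k, (1 <= k <= m - 1)%N -> \sum_(j < m) alpha j * a j ^+ k = 0) ->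
  (forall j, a (rev_ord j) = - Num.conj (a j)) ->
  forall j, alpha (rev_ord j) = Num.conj (alpha j).
Proof.
move=> a_inj mom a_rev.
suff h j : Num.conj (alpha (rev_ord j)) - alpha j = 0.
  by move=> j; have /eqP := h (rev_ord j); rewrite rev_ordK subr_eq0 => /eqP <-.
apply: (moments_inj a_inj (d := fun j => Num.conj (alpha (rev_ord j)) - alpha
  j)) => {j} k km.
under eq_bigr do rewrite mulrBl; rewrite sumrB.
have -> : \sum_(j < m) Num.conj (alpha (rev_ord j)) * a j ^+ k =
    (-1) ^+ k * Num.conj (\sum_(j < m) alpha j * a j ^+ k).
  rewrite rmorph_sum (reindex_inj rev_ord_inj) mulr_sumr;
    apply: eq_bigr => j _ /=.
  rewrite rev_ordK a_rev rmorphM rmorphXn (exprNn (Num.conj (a j))) mulrCA;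
    congr (_ * _).
have [->|k0] := eqVneq k 0%N.
  under eq_bigr do rewrite expr0 mulr1.
  by rewrite alpha_sum rmorph1 expr0 mul1r subrr.
by rewrite mom ?rmorph0 ?mulr0 ?subr0//; lia.
Qed.

(** Reflection turns arg into pi - arg, keeps |a j| and changes the sign of Im (alpha j), so it
    exchanges the terms of c_l and c_r; their sum is 1. *)
Lemma symmetric_constants : injective a ->
  (forall k, (1 <= k <= m - 1)%N -> \sum_(j < m) alpha j * a j ^+ k = 0) ->
  (forall j, a (rev_ord j) = - Num.conj (a j)) ->
  c_left a alpha = 1 / 2 /\ c_right a alpha = 1 / 2.
Proof.
move=> a_inj mom a_rev.
suff : c_left a alpha = c_right a alpha by rewrite c_leftE c_rightE; split; lra.
rewrite /c_left /c_right; congr (_ * _).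
rewrite [RHS](reindex_inj rev_ord_inj); apply: eq_bigr => j _ /=.
rewrite (alpha_rev_ord a_inj mom a_rev).
have q0 := a_upper j; have q0' := a_upper (rev_ord j).
have cm : cmod (a (rev_ord j)) = cmod (a j).
  by rewrite a_rev /cmod normrN norm_conjC.
rewrite !cargE// cm a_rev.
case: (a j) q0 => p q; case: (alpha j) => b g /= q0.
by rewrite !opprK mulNr atanN; field.
Qed.

End kernel.

(** * Smoothed spectral measure *)

Section spectral_integral.
Context (R : realType) (V : completeNormedModType R[i]).
Variable dot : {dot V for Num.conj}.
Hypothesis dotP : induces_norm dot.
Variable E : set R -> {linear V -> V}.
Hypothesis EP : projection_valued_measure dot E.
Variable D : set R.
Hypothesis mD : measurable D.
Hypothesis ED : forall v, E D v = v.
Implicit Type f : R -> R.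

Local Notation mu := (pvm_measure dotP EP).

(** The complement of D is null: E (~[D) v = E (~] D) (E D v) = E set0 v = 0. *)
Lemma integral_scalar_measure v f : bounded_measurable f ->
  (\int[scalar_measure dot E v]_(x in D) (f x)%:E = \int[mu v]_x (f x)%:E)%E.
Proof.
move=> bf; rewrite (@eq_integral_on_measurable _ _ (mu v)); last first.
  by move=> A mA; rewrite /pvm_measure asboolT.
rewrite [RHS](negligible_integral (N := ~` D))//.
- by rewrite setTD setCK.
- exact: measurableC.
- exact: pvm_integrable.
rewrite /= pvm_measureE; last exact: measurableC.
have [_ _ EI _] := EP; rewrite -[in E (~` D) v](ED v) -EI ?setICl//; last first.
  exact: measurableC.
by rewrite (pvm0 EP) rnorm0 expr0n.
Qed.

Lemma complex_integral_real v f : bounded_measurable f ->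
  complex_integral (scalar_measure dot E v) D (fun x => (f x)%:C) =
  (\int[mu v]_x f x)%:C.
Proof.
move=> bf; rewrite /complex_integral /=; congr Complex.
  by rewrite integral_scalar_measure.
rewrite (integral_scalar_measure v (@bounded_measurable_cst R 0)).
by rewrite integral0.
Qed.

Lemma integral_sqr_lty v f : bounded_measurable f ->
  (\int[scalar_measure dot E v]_(x in D) ((complex.Re `|(f x)%:C|) ^+ 2)%:E <
    +oo)%E.
Proof.
move=> bf; have b2 : bounded_measurable (fun x => f x ^+ 2).
  have [mf [M fM]] := bf; split; first exact: measurable_funX.
  by exists (M ^+ 2) => x; rewrite normrX ler_sqr ?nnegrE// (le_trans _ (fM x)).
have -> : (fun x => ((complex.Re `|(f x)%:C|) ^+ 2)%:E) = (fun x =>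
  (f x ^+ 2)%:E).
  apply/funext => x; rewrite -[complex.Re _]/(cmod _) cmod_real.
  by rewrite real_normK ?num_real.
rewrite integral_scalar_measure//.
have /(integrable_fin_num measurableT) := pvm_integrable dotP EP v b2.
by rewrite fin_numElt => /andP[].
Qed.

(** The operator built by the calculus shows that the choice in [spectral_integral] does not fall
    back on its default; the chosen operator then has full domain and the right form. *)
Lemma spectral_integral_calculus f : bounded_measurable f ->
  exists T : {linear V -> V}, is_calculus dotP EP f T /\
    forall v, spectral_integral dot E D (fun x => (f x)%:C) v = T v.
Proof.
move=> bf; set O := spectral_integral _ _ _ _.
have domE : setT = [set v | (\int[scalar_measure dot E v]_(x in D)
    ((complex.Re `|(f x)%:C|) ^+ 2)%:E < +oo)%E].
  by apply/seteqP; split=> // v _; exact: integral_sqr_lty.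
have [domO formO] : is_spectral_integral dot E D (fun x => (f x)%:C) O.
  apply: xgetPex; have [T fT] := is_calculus_ex dotP EP bf.
  exists (@Operator R V setT T I (fun _ _ _ _ _ => I)
    (fun c u v _ _ => linearP T c u v)).
  by split=> //= v _; rewrite fT complex_integral_real.
rewrite -domE in domO.
have Olin : linear O by move=> c u v; apply: op_linear; rewrite domO.
pose T : {linear V -> V} :=
  HB.pack (O : V -> V) (GRing.isLinear.Build R[i] V V _ O Olin).
by exists T; split=> // v /=; rewrite formO ?domO// complex_integral_real.
Qed.

End spectral_integral.

(** * Uniqueness of the vector-valued Riemann integral *)

Section riemann.
Context (R : realType) (V : completeNormedModType R[i]).

(** Arbitrarily fine partitions keep [is_riemann_integral] from holding vacuously, so two integrals
    can be compared on a common one. The tags are left end points. *)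
Lemma tagged_partition_ex (a b d : R) : a < b -> 0 < d ->
  exists n (x : nat -> R), tagged_partition a b n x x /\
    forall k, (k < n)%N -> x k.+1 - x k < d.
Proof.
move=> ab d0; have ba0 : 0 < b - a by rewrite subr_gt0.
have [n nd] : exists n : nat, (b - a) / d < n.+1%:R.
  exists (Num.truncn ((b - a) / d)).
  by rewrite truncnS_gt// divr_ge0 ?ltW.
pose h := (b - a) / n.+1%:R; have h0 : 0 < h by rewrite divr_gt0.
exists n.+1, (fun k => a + h * k%:R); split.
  split=> [||k _]; first by rewrite mulr0 addr0.
    by rewrite divfK// addrC subrK.
  by rewrite lexx lerD2l ler_pM2l// ler_nat leqnSn.
move=> k _; have -> : a + h * k.+1%:R - (a + h * k%:R) = h.
  by rewrite -addn1 natrD; ring.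
by rewrite ltr_pdivrMr// mulrC -ltr_pdivrMr.
Qed.

Lemma riemann_integralE (f : R -> V) (a b : R) (I : V) : a < b ->
  is_riemann_integral f a b I -> riemann_integral f a b = I.
Proof.
move=> ab fI; have : is_riemann_integral f a b (riemann_integral f a b).
  by apply: xgetPex; exists I.
set J := riemann_integral _ _ _ => fJ.
apply/eqP; rewrite -subr_eq0; apply/eqP/rnorm_eq0/eqP.
rewrite eq_le rnorm_ge0 andbT; apply/ler_addgt0Pl => e e0; rewrite addr0.
have e20 : 0 < e / 2 by rewrite divr_gt0.
have [d d0 dI] := fI _ e20; have [d' d'0 dJ] := fJ _ e20.
have dd'0 : 0 < Num.min d d' by rewrite lt_min d0.
have dd' : Num.min d d' <= d /\ Num.min d d' <= d'
  by rewrite !ge_min !lexx orbT.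
have [n [x [xp xd]]] := tagged_partition_ex ab dd'0.
have := dI _ _ _ xp (fun k kn => lt_le_trans (xd k kn) dd'.1).
have := dJ _ _ _ xp (fun k kn => lt_le_trans (xd k kn) dd'.2).
rewrite !rnormE !ltcR => h1 h2.
rewrite -(subrKA (riemann_sum f n x x)) (le_trans (ler_rnormD _ _))//.
by rewrite rnormBC; move: h1 h2; clear; lra.
Qed.

End riemann.

(** * Scalar estimates and limits for the smoothed indicator *)

Section smoothing.
Context (R : realType) (m : nat) (a alpha : 'I_m -> R[i]).
Hypothesis a_upper : forall j, 0 < complex.Im (a j).
Hypothesis alpha_sum : \sum_(j < m) alpha j = 1.

Local Notation k := (real_kernel a alpha).
Local Notation G := (kernel_primitive a alpha).

Definition scaled_real_kernel (eps x y : R) : R := eps^-1 * k ((x - y) / eps).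

Definition smoothed_indicator (l r eps y : R) : R :=
  G ((r - y) / eps) - G ((l - y) / eps).

Lemma bounded_measurable_affine (f : R -> R) (x eps : R) :
  bounded_measurable f -> bounded_measurable (fun y => f ((x - y) / eps)).
Proof.
move=> [mf [M fM]]; split; last by exists M => y.
apply: measurableT_comp => //; apply: measurable_funM => //.
exact: measurable_funB.
Qed.

Lemma bounded_measurable_real_kernel : bounded_measurable k.
Proof.
split.
  apply: continuous_measurable_fun => x; apply/cvgrPdist_lt => e e0.
  have [L [L0 kL]] := real_kernel_lipschitz alpha a_upper.
  near=> y; apply: (le_lt_trans (kL _ _)); rewrite mulrC -ltr_pdivlMr//.
  by near: y; apply: cvgr_dist_lt => //; rewrite divr_gt0.
exact: real_kernel_bounded.
Unshelve. all: by end_near. Qed.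

Lemma bounded_measurable_primitive : bounded_measurable G.
Proof.
split; last exact: kernel_primitive_bounded.
apply: continuous_measurable_fun => x; apply: differentiable_continuous.
by apply/derivable1_diffP; have h := is_derive_kernel_primitive alpha a_upper x;
  exact: ex_derive.
Qed.

Lemma bounded_measurable_smoothed_indicator l r eps :
  bounded_measurable (smoothed_indicator l r eps).
Proof.
by apply: bounded_measurableB; apply: bounded_measurable_affine;
  exact: bounded_measurable_primitive.
Qed.

(** Uniform in y, as a norm estimate requires. On each subinterval the mean value theorem gives a
    point c within d / eps of the scaled tag; the Lipschitz bound and the prefactor of the kernel
    each cost one 1 / eps. *)
Lemma riemann_sum_smoothed_indicator : exists L, 0 < L /\
  forall eps l r d n (x t : nat -> R) y, 0 < eps -> 0 < d ->
  tagged_partition l r n x t -> (forall j, (j < n)%N -> x j.+1 - x j < d) ->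
  `|\sum_(j < n) (x j.+1 - x j) * scaled_real_kernel eps (t j) y -
    smoothed_indicator l r eps y| <= (r - l) * L * d / eps ^+ 2.
Proof.
have [L [L0 kL]] := real_kernel_lipschitz alpha a_upper.
exists L; split=> // eps l r d n x t y e0 d0 [xl xr xt] xd.
have e20 : 0 < eps ^+ 2 by rewrite exprn_gt0.
have -> : smoothed_indicator l r eps y =
    \sum_(j < n) (G ((x j.+1 - y) / eps) - G ((x j - y) / eps)).
  rewrite -(big_mkord xpredT (fun j => G ((x j.+1 - y) / eps) - G ((x j - y) /
    eps))).
  by rewrite telescope_sumr// xl xr.
have -> : (r - l) * L * d / eps ^+ 2 =
    \sum_(j < n) (x j.+1 - x j) * (L * d / eps ^+ 2).
  rewrite -mulr_suml -(big_mkord xpredT (fun j => x j.+1 - x j)).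
  by rewrite telescope_sumr// xl xr !mulrA.
rewrite -sumrB (le_trans (ler_norm_sum _ _ _))//; apply: ler_sum => j _.
have /andP[xtj txj] := xt _ (ltn_ord j); have xdj := xd _ (ltn_ord j).
have xx : x j <= x j.+1 by exact: le_trans xtj txj.
have xxe : (x j - y) / eps <= (x j.+1 - y) / eps.
  by rewrite ler_pM2r ?invr_gt0// lerB.
have [c /andP[c1 c2] ->] := kernel_primitive_MVT alpha a_upper xxe.
have -> : (x j.+1 - x j) * scaled_real_kernel eps (t j) y -
    k c * ((x j.+1 - y) / eps - (x j - y) / eps) =
    (x j.+1 - x j) * (eps^-1 * (k ((t j - y) / eps) - k c)).
  by rewrite /scaled_real_kernel; field; rewrite gt_eqF.
rewrite normrM ger0_norm ?subr_ge0// ler_wpM2l ?subr_ge0//.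
rewrite normrM gtr0_norm ?invr_gt0//.
have -> : L * d / eps ^+ 2 = eps^-1 * (L * (d / eps)) by field; rewrite gt_eqF.
rewrite ler_pM2l ?invr_gt0// (le_trans (kL _ _))// ler_pM2l//.
move: c1 c2; rewrite ler_pdivrMr// ler_pdivlMr// => c1 c2.
have -> : (t j - y) / eps - c = (t j - y - c * eps) / eps by field;
  rewrite gt_eqF.
rewrite normrM [`|eps^-1|]gtr0_norm ?invr_gt0// ler_pM2r ?invr_gt0//.
rewrite ler_norml; apply/andP; split; lra.
Qed.

(** The case c = 0, where the value stays G 0, occurs when y is an end point and produces the
    end-point weights. *)
Lemma cvg_kernel_primitive_scaled (c : R) (u : nat -> R) :
  (forall n, 0 < u n) -> u @ \oo --> 0 ->
  (fun n => G (c / u n)) @ \oo --> 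
    (if 0 < c then 1 / 2 else if c < 0 then - 1 / 2 else G 0).
Proof.
move=> u0 cu; have [->|c0] := eqVneq c 0.
  by rewrite ltxx; under eq_fun do rewrite mul0r; exact: cvg_cst.
have -> : (if 0 < c then 1 / 2 else if c < 0 then - 1 / 2 else G 0) = Num.sg c /
  2.
  by move: c0; case: sgrP.
rewrite [X in X @ _ --> _](_ : _ = (fun n => G (Num.sg c * (`|c| / u n)))).
  apply: cvg_kernel_primitive => //; last by rewrite normr_sg c0.
  apply/cvgryPge => A; have A0 : 0 < `|A| + 1 by rewrite ltr_wpDl.
  have d0 : 0 < `|c| / (`|A| + 1) by rewrite divr_gt0// normr_gt0.
  move/cvgrPdist_lt : cu => /(_ _ d0); apply: filterS => n.
  rewrite sub0r normrN (gtr0_norm (u0 n)) ltr_pdivlMr// => h.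
  rewrite ler_pdivlMr// (le_trans _ (ltW h))// mulrC ler_pM2l//.
  by rewrite (le_trans (ler_norm _))// lerDl.
by apply/funext => n; rewrite mulrA -numEsg.
Qed.

Definition limit_indicator (l r y : R) : R :=
  \1_([set` `]l, r[]) y + c_left a alpha * \1_([set l]) y +
  c_right a alpha * \1_([set r]) y.

Lemma cvg_smoothed_indicator (l r y : R) (u : nat -> R) : l < r ->
  (forall n, 0 < u n) -> u @ \oo --> 0 ->
  (fun n => smoothed_indicator l r (u n) y) @ \oo --> limit_indicator l r y.
Proof.
move=> lr u0 cu.
have -> : limit_indicator l r y =
    (if 0 < r - y then 1 / 2 else if r - y < 0 then - 1 / 2 else G 0) -
    (if 0 < l - y then 1 / 2 else if l - y < 0 then - 1 / 2 else G 0).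
  rewrite /limit_indicator (c_leftE a_upper alpha_sum) (c_rightE a_upper
    alpha_sum).
  rewrite !indicE !subr_gt0 !subr_lt0.
  have -> : (y \in [set` `]l, r[]) = (l < y < r) by rewrite mem_setE in_itv.
  have -> : (y \in [set l]) = (l == y).
    by apply/idP/eqP => [/set_mem ->|->]; [|exact/mem_set].
  have -> : (y \in [set r]) = (r == y).
    by apply/idP/eqP => [/set_mem ->|->]; [|exact/mem_set].
  have [ly|yl|ly] := ltgtP l y; have [ry|yr|ry] := ltgtP r y;
    rewrite /=; lra.
by apply: cvgB; exact: cvg_kernel_primitive_scaled.
Qed.

Lemma bounded_measurable_limit_indicator l r :
  bounded_measurable (limit_indicator l r).
Proof.
apply: bounded_measurableD; [apply: bounded_measurableD|];
  rewrite ?bounded_measurableZ//; try apply: bounded_measurableZ;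
  exact: bounded_measurable_indic.
Qed.

End smoothing.

(** * Transfer of the scalar limits to operators *)

Section main.
Context (R : realType) (V : completeNormedModType R[i]).
Variable dot : {dot V for Num.conj}.
Hypothesis dotP : induces_norm dot.
Variables (H : operator V) (E : set R -> {linear V -> V}).
Hypothesis EP : projection_valued_measure dot E.
Hypothesis EH : forall v, E (real_spectrum H) v = v.
Variables (m : nat) (a alpha : 'I_m -> R[i]).
Hypothesis a_upper : forall j, 0 < complex.Im (a j).
Hypothesis alpha_sum : \sum_(j < m) alpha j = 1.

Local Notation K := (rational_kernel a alpha).
Local Notation mu := (pvm_measure dotP EP).

Lemma smoothed_measure_calculus eps x : exists T : {linear V -> V},
  is_calculus dotP EP (scaled_real_kernel a alpha eps x) T /\
  forall v, smoothed_measure dot H E K eps x v = T v.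
Proof.
have b : bounded_measurable (scaled_real_kernel a alpha eps x).
  apply/bounded_measurableZ/bounded_measurable_affine.
  exact: bounded_measurable_real_kernel.
have [T [kT TE]] := spectral_integral_calculus dotP EP (measurable_real_spectrum
  H) EH b.
exists T; split=> // v; rewrite -TE /smoothed_measure.
congr (op_fun (spectral_integral _ _ _ _) _); apply/funext => y.
by rewrite /scaled_kernel rational_kernelE// -rmorphM.
Qed.

(** The operator Riemann sum is the calculus of the scalar Riemann sum, so the uniform error of the
    functions becomes a norm error. *)
Lemma is_riemann_integral_smoothed_measure eps l r (T : {linear V -> V}) v :
  0 < eps -> l < r ->
  is_calculus dotP EP (smoothed_indicator a alpha l r eps) T ->
  is_riemann_integral (fun x => smoothed_measure dot H E K eps x v) l r (T v).
Proof.
move=> eps0 lr fT e e0.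
have [L [L0 LP]] := riemann_sum_smoothed_indicator alpha a_upper.
have v1 : 0 < rnorm v + 1 by rewrite ltr_wpDl ?rnorm_ge0.
have rl : 0 < r - l by rewrite subr_gt0.
have den0 : 0 < 2 * (r - l) * L * (rnorm v + 1) by rewrite !mulr_gt0.
(* Chosen so that the bound of [is_calculus_sup], with its factor 2, equals e |v| / (|v| + 1) <
   e. *)
pose d := e * eps ^+ 2 / (2 * (r - l) * L * (rnorm v + 1)).
have d0 : 0 < d by rewrite divr_gt0// mulr_gt0// exprn_gt0.
exists d => // n x t xt xd.
have [S SP] := choice (fun z => smoothed_measure_calculus eps z).
have bk z : bounded_measurable (scaled_real_kernel a alpha eps z).
  apply/bounded_measurableZ/bounded_measurable_affine.
  exact: bounded_measurable_real_kernel.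
have bF (j : 'I_n) : bounded_measurable
    (fun y => (x j.+1 - x j) * scaled_real_kernel a alpha eps (t j) y).
  exact: bounded_measurableZ.
have FS (j : 'I_n) : is_calculus dotP EP
    (fun y => (x j.+1 - x j) * scaled_real_kernel a alpha eps (t j) y)
    ((x j.+1 - x j)%:C \*: S (t j)).
  by apply: is_calculusZ => //; have [] := SP (t j).
have [Q [FQ QE]] := is_calculus_sum (index_enum 'I_n) bF FS.
have -> : riemann_sum (fun x => smoothed_measure dot H E K eps x v) n x t = Q v.
  rewrite QE; apply: eq_bigr => j _ /=; congr (_ *: _).
  by have [_ ->] := SP (t j).
have bsi := bounded_measurable_smoothed_indicator a_upper alpha_sum l r eps.
have bs : bounded_measurable (fun y =>
    \sum_(j < n) (x j.+1 - x j) * scaled_real_kernel a alpha eps (t j) y).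
  exact: bounded_measurable_sum.
have QT : is_calculus dotP EP (fun y =>
    \sum_(j < n) (x j.+1 - x j) * scaled_real_kernel a alpha eps (t j) y +
    -1 * smoothed_indicator a alpha l r eps y) (Q \+ (-1)%:C \*: T).
  apply: is_calculusD => //; first exact: bounded_measurableZ.
  exact: is_calculusZ.
have C0 : 0 < (r - l) * L * d / eps ^+ 2.
  by rewrite divr_gt0 ?exprn_gt0// mulr_gt0// mulr_gt0.
have := is_calculus_sup (C := (r - l) * L * d / eps ^+ 2) _ _ C0 QT v.
rewrite /= rmorphN rmorph1 scaleN1r rnormE ltcR => h.
apply: le_lt_trans (h _ _) _.
- by apply: bounded_measurableD => //; exact: bounded_measurableZ.
- by move=> y; rewrite mulN1r; exact: LP.
have -> : 2 * ((r - l) * L * d / eps ^+ 2) * rnorm v = e * (rnorm v / (rnorm v +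
  1)).
  by rewrite /d; field; rewrite !gt_eqF.
by rewrite gtr_pMr// ltr_pdivrMr// mul1r ltrDl.
Qed.

Lemma cvg_riemann_integral_smoothed_measure l r v : l < r ->
  riemann_integral (fun x => smoothed_measure dot H E K eps x v) l r
    @[eps --> 0^'+] -->
  E [set` `]l, r[] v + (c_left a alpha)%:C *: E [set l] v
    + (c_right a alpha)%:C *: E [set r] v.
Proof.
move=> lr; pose f := limit_indicator a alpha l r.
pose T0 : {linear V -> V} := E [set` `]l, r[] \+ (c_left a alpha)%:C \*: E [set
  l]
    \+ (c_right a alpha)%:C \*: E [set r].
have bf : bounded_measurable f by exact: bounded_measurable_limit_indicator.
have bF eps : bounded_measurable (smoothed_indicator a alpha l r eps).
  exact: bounded_measurable_smoothed_indicator.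
have fT0 : is_calculus dotP EP f T0.
  have bi (A : set R) : measurable A -> bounded_measurable (\1_A : R -> R).
    exact: bounded_measurable_indic.
  have bZ c x : bounded_measurable (fun y => c * \1_([set x] : set R) y).
    exact/bounded_measurableZ/bi.
  apply: is_calculusD; [apply: bounded_measurableD| |apply: is_calculusD|];
    rewrite //; try exact: bi; try exact: is_calculus_indic;
    by apply: is_calculusZ; [exact: bi|exact: is_calculus_indic].
have [M GM] := kernel_primitive_bounded a_upper alpha_sum.
have FM eps y : `|smoothed_indicator a alpha l r eps y| <= M + M.
  by rewrite (le_trans (ler_normB _ _))// lerD.
have [N0 fN0] := bf.2.
(* Dominates the difference of the limit and the smoothed indicator for all eps at once; the 1
   ensures C > 0. *)
pose C := M + M + N0 + 1.
have M0 : 0 <= M by rewrite (le_trans _ (GM 0)).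
have N00 : 0 <= N0 by rewrite (le_trans _ (fN0 0)).
have C0 : 0 < C by rewrite /C ltr_wpDl// !addr_ge0.
have fF eps y : `|f y - smoothed_indicator a alpha l r eps y| <= C.
  rewrite (le_trans (ler_normB _ _))// /C.
  by have := fN0 y; have := FM eps y; lra.
(* By [is_calculus_bound] this L^1 distance, times 2 C, controls the squared norm of the error. *)
pose J eps := \int[mu v]_y `|f y - smoothed_indicator a alpha l r eps y|.
have J0 : J eps @[eps --> 0^'+] --> 0.
  (* Dominated convergence concerns sequences, so the right limit is tested along positive sequences
     tending to 0. *)
  apply/cvg_at_rightP => u [u0 cu].
  rewrite (_ : 0 = \int[mu v]_y 0); last by rewrite Rintegral_cst// mul0r.
  apply: (cvg_Rintegral_bounded (M := C)) (pvm_measureT_lty dotP EP v) _ _ _ _.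
  - by move=> n; have [] := bounded_measurable_norm (bounded_measurableB bf (bF
      (u n))).
  - exact: measurable_cst.
  - by move=> n x; rewrite normr_id.
  - move=> y; rewrite -(normr0 R) -(subrr (f y)); apply: cvg_norm; apply: cvgB.
      exact: cvg_cst.
    exact: cvg_smoothed_indicator.
have JP eps : 0 < eps ->
    rnorm (T0 v - riemann_integral (fun x => smoothed_measure dot H E K eps x v)
      l r) ^+ 2
    <= 2 * C * J eps.
  move=> eps0; have [T fT] := is_calculus_ex dotP EP (bF eps).
  rewrite (riemann_integralE lr (is_riemann_integral_smoothed_measure v eps0 lr
    fT)).
  have h : is_calculus dotP EP (fun y => f y + -1 * smoothed_indicator a alpha l
    r eps y)
      (T0 \+ (-1)%:C \*: T).
    apply: is_calculusD => //; first exact: bounded_measurableZ.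
    exact: is_calculusZ.
  have b : bounded_measurable (fun y => f y + -1 * smoothed_indicator a alpha l
    r eps y).
    by apply: bounded_measurableD => //; exact: bounded_measurableZ.
  have := is_calculus_bound (C := C) b _ C0 h v.
  rewrite [in X in _ -> X]/J /= rmorphN rmorph1 scaleN1r.
  under [in X in (_ -> X) -> _]eq_Rintegral do rewrite mulN1r.
  by apply=> y; rewrite mulN1r.
apply: cvg_rnorm => e e0.
have e1 : 0 < e ^+ 2 / (2 * C) by rewrite divr_gt0 ?exprn_gt0 ?mulr_gt0.
near=> eps.
have eps0 : 0 < eps by near: eps; exact: nbhs_right_gt.
rewrite -(@ltr_pXn2r _ 2)// ?nnegrE ?rnorm_ge0 ?(ltW e0)//.
apply: le_lt_trans (JP _ eps0) _.
rewrite mulrC -ltr_pdivlMr ?mulr_gt0//.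
have : `|0 - J eps| < e ^+ 2 / (2 * C) by near: eps; exact: cvgr_dist_lt.
by rewrite sub0r normrN; apply: le_lt_trans; exact: ler_norm.
Unshelve. all: by end_near. Qed.

End main.

Unset Implicit Arguments.

Theorem theorem3p2 (R : realType) (V : completeNormedModType R[i])
    (dot : {dot V for Num.conj}) (hdot : induces_norm dot)
    (H : operator V) (hH : self_adjoint dot H)
    (E : set R -> {linear V -> V}) (hE : spectral_measure_of dot H E)
    (m : nat) (hm : (1 <= m)%N) (a alpha : 'I_m -> R[i])
    (a_inj : injective a) (a_upper : forall j, 0 < complex.Im (a j))
    (alpha_sum : \sum_(j < m) alpha j = 1)
    (alpha_moments : forall k : nat, (1 <= k <= m - 1)%N ->
       \sum_(j < m) alpha j * a j ^+ k = 0) :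
  let K := rational_kernel a alpha in
  (forall (l r : R) (psi : V), l < r ->
     (forall eps : R, 0 < eps ->
        riemann_integrable (fun x => smoothed_measure dot H E K eps x psi) l r)
     /\
     riemann_integral (fun x => smoothed_measure dot H E K eps x psi) l r
       @[eps --> 0^'+] -->
     E [set` `]l, r[] psi + (c_left a alpha)%:C *: E [set l] psi
                   + (c_right a alpha)%:C *: E [set r] psi)
  /\
  ((forall j : 'I_m, a (rev_ord j) = - Num.conj (a j)) ->
     c_left a alpha = 1 / 2 /\ c_right a alpha = 1 / 2).
Proof.
move=> K; have [EP EH _] := hE; split=> [l r psi lr|a_sym]; last first.
  exact: symmetric_constants.
split=> [eps eps0|].
  have [T fT] := is_calculus_ex hdot EP
    (bounded_measurable_smoothed_indicator a_upper alpha_sum l r eps).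
  by exists (T psi); exact: is_riemann_integral_smoothed_measure fT.
exact: cvg_riemann_integral_smoothed_measure.
Qed.
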